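(* Let $E$ be a Banach space with a normalized 1-unconditional basis $(e_j)$ and biorthogonal system $(e_j^* )\subseteq E^*$. Let $(X_n)$ be a sequence of Banach spaces, $Z$ a Banach space, $1\le p\le\infty$, and $T:\left(\sum_{n=1}^\infty X_n\right)_E\to Z$ a $p$-summing operator. Put $T_n=T_{|X_n}$ for all $n\in\mathbb N$. If $E^*$ is $p$-convex then for all $m\in\mathbb N$ $$\Big\|\sum_{j=1}^m \pi_p(T_j)e_j^*\Big\|\le K^p(E^* )\,\pi_p(T).$$ If, in addition, $(e_j^* )$ is boundedly complete or $\sum_{n=1}^\infty T_n$ converges to $T$ in the $p$-summing norm, then $\sum_{j=1}^\infty\pi_p(T_j)e_j^*$ converges in $E^*$ and $$\Big\|\sum_{j=1}^\infty \pi_p(T_j)e_j^*\Big\|\le K_{p'}(E)\,\pi_p(T).$$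
   Context: $\pi_p$ is the $p$-summing norm for $1\le p<\infty$; $\pi_\infty$ is the operator norm (so ''$\infty$-summing'' means bounded). $p'$ is the conjugate exponent, $1/p+1/p'=1$. $\left(\sum_{n=1}^\infty X_n\right)_E$ is the Banach space of all $x\in\prod_n X_n$ such that $\sum_n\|x(n)\|e_n$ converges in $E$, with norm $\|x\|=\|\sum_n\|x(n)\|e_n\|_E$. $X_n$ is identified with the subspace of all $x$ supported on coordinate $n$. In $\sum_n T_n$, $T_n$ is regarded as an operator on the whole direct sum by composing with the canonical projection onto $X_n$. $E$ is a Banach lattice under the order given coordinatewise by $(e_j)$, and $E^*$ is given the dual lattice structure. A Banach lattice $L$ is $p$-convex if there is $K$ with $\|(\sum_i|x_i|^p)^{1/p}\|\le K(\sum_i\|x_i\|^p)^{1/p}$ for all finite families in $L$, and $q$-concave if there is $K$ with $(\sum_i\|x_i\|^q)^{1/q}\le K\|(\sum_i|x_i|^q)^{1/q}\|$ (sums replaced by maxima/suprema if the exponent is $\infty$); the smallest constants are $K^p(L)$ and $K_q(L)$. *)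

(* Defs.v *)
From HB Require Import structures.
From mathcomp Require Import all_boot all_order all_algebra.
From mathcomp Require Import all_classical all_reals all_analysis.
From mathcomp Require Import ring lra.

Set Implicit Arguments.
Unset Strict Implicit.
Unset Printing Implicit Defensive.

Import Order.TTheory GRing.Theory Num.Theory.
Import numFieldNormedType.Exports.

Local Open Scope classical_set_scope.
Local Open Scope ring_scope.

Section continuous_dual.
Context {R : realType} (V : normedModType R).

Record dual := Dual {
  dual_fun :> V -> R^o;
  dual_linear : linear dual_fun;
  dual_continuous : continuous dual_fun }.

HB.instance Definition _ := gen_eqMixin dual.
HB.instance Definition _ := gen_choiceMixin dual.

Lemma dualP (f g : dual) : (f : V -> R) =1 g -> f = g.
Proof.
case: f g => [f lf cf] [g lg cg] /= /funext fg.
by subst g; congr Dual; exact: Prop_irrelevance.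
Qed.

HB.instance Definition _ (f : dual) :=
  GRing.isLinear.Build R V R^o *:%R (dual_fun f) (dual_linear f).

Fact dual_zero_linear : linear (fun _ : V => 0 : R^o).
Proof. by move=> a x y; rewrite scaler0 addr0. Qed.
Fact dual_zero_continuous : continuous (fun _ : V => 0 : R^o).
Proof. by move=> x; exact: cvg_cst. Qed.
Definition dual_zero := Dual dual_zero_linear dual_zero_continuous.

Fact dual_opp_linear (f : dual) : linear (fun x : V => - f x : R^o).
Proof. by move=> a x y; rewrite linearP opprD scalerN. Qed.
Fact dual_opp_continuous (f : dual) : continuous (fun x : V => - f x : R^o).
Proof. by move=> x; apply: cvgN; exact: dual_continuous. Qed.
Definition dual_opp f := Dual (dual_opp_linear f) (@dual_opp_continuous f).

Fact dual_add_linear (f g : dual) : linear (fun x : V => f x + g x : R^o).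
Proof. by move=> a x y; rewrite !linearP scalerDr addrACA. Qed.
Fact dual_add_continuous (f g : dual) :
  continuous (fun x : V => f x + g x : R^o).
Proof. by move=> x; apply: cvgD; exact: dual_continuous. Qed.
Definition dual_add f g := Dual (dual_add_linear f g) (@dual_add_continuous f g).

Fact dual_scale_linear (c : R) (f : dual) : linear (fun x : V => c *: f x).
Proof. by move=> a x y; rewrite linearP scalerDr !scalerA mulrC. Qed.
Fact dual_scale_continuous (c : R) (f : dual) :
  continuous (fun x : V => c *: f x).
Proof. by move=> x; apply: cvgZl_tmp; exact: dual_continuous. Qed.
Definition dual_scale c f :=
  Dual (dual_scale_linear c f) (@dual_scale_continuous c f).

Fact dual_addA : associative dual_add.
Proof. by move=> f g h; apply: dualP => x /=; rewrite addrA. Qed.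
Fact dual_addC : commutative dual_add.
Proof. by move=> f g; apply: dualP => x /=; rewrite addrC. Qed.
Fact dual_add0 : left_id dual_zero dual_add.
Proof. by move=> f; apply: dualP => x /=; rewrite add0r. Qed.
Fact dual_addN : left_inverse dual_zero dual_opp dual_add.
Proof. by move=> f; apply: dualP => x /=; rewrite addNr. Qed.
HB.instance Definition _ :=
  GRing.isZmodule.Build dual dual_addA dual_addC dual_add0 dual_addN.

Fact dual_scaleA a b f : dual_scale a (dual_scale b f) = dual_scale (a * b) f.
Proof. by apply: dualP => x /=; rewrite scalerA. Qed.
Fact dual_scale1 : left_id 1 dual_scale.
Proof. by move=> f; apply: dualP => x /=; rewrite scale1r. Qed.
Fact dual_scaleDr : right_distributive dual_scale +%R.
Proof. by move=> a f g; apply: dualP => x /=; rewrite scalerDr. Qed.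
Fact dual_scaleDl f : {morph dual_scale^~ f : a b / a + b}.
Proof. by move=> a b; apply: dualP => x /=; rewrite scalerDl. Qed.
HB.instance Definition _ := GRing.Zmodule_isLmodule.Build R dual
  dual_scaleA dual_scale1 dual_scaleDr dual_scaleDl.

Lemma dual_addE (f g : dual) x : (f + g) x = f x + g x.
Proof. by []. Qed.
Lemma dual_scaleE c (f : dual) x : (c *: f) x = c *: f x.
Proof. by []. Qed.

Definition dual_norm (f : dual) : R :=
  sup [set `|f x| | x in [set x : V | `|x| <= 1]].

Lemma dual_bounded (f : dual) : exists M : R, forall x, `|f x| <= M * `|x|.
Proof.
have /linear_bounded_continuous/linear_boundedP : continuous f.
  exact: dual_continuous.
by case=> M [_ fM]; exists (M + 1) => x; apply: fM; rewrite ltrDl.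
Qed.

Lemma dual_norm_has_sup (f : dual) :
  has_sup [set `|f x| | x in [set x : V | `|x| <= 1]].
Proof.
split; first by exists `|f 0|, 0 => //=; rewrite normr0.
have [M fM] := dual_bounded f.
exists `|M| => _ [x /= x1 <-]; apply: le_trans (fM x) _.
apply: (@le_trans _ _ (`|M| * `|x|)); first by rewrite ler_wpM2r// ler_norm.
by rewrite ler_piMr.
Qed.

Lemma dual_norm_ub (f : dual) x : `|x| <= 1 -> `|f x| <= dual_norm f.
Proof.
by move=> x1; apply: ub_le_sup; [case: (dual_norm_has_sup f)|exists x].
Qed.

Lemma ler_dual_norm (f : dual) x : `|f x| <= dual_norm f * `|x|.
Proof.
have [->|x0] := eqVneq x 0; first by rewrite linear0 !normr0 mulr0.
have nx : 0 < `|x| by rewrite normr_gt0.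
rewrite -ler_pdivrMr//.
have -> : `|f x| / `|x| = `|f (`|x|^-1 *: x)|.
  by rewrite linearZ normrZ normfV normr_id mulrC.
by apply: dual_norm_ub; rewrite normrZ normfV normr_id mulVf// gt_eqF.
Qed.

Lemma dual_norm_le (f : dual) M :
  (forall x, `|x| <= 1 -> `|f x| <= M) -> dual_norm f <= M.
Proof.
move=> fM; apply: ge_sup; first by case: (dual_norm_has_sup f).
by move=> _ [x /= x1 <-]; exact: fM.
Qed.

Fact dual_normD f g : dual_norm (f + g) <= dual_norm f + dual_norm g.
Proof.
apply: dual_norm_le => x x1; apply: le_trans (ler_normD _ _) _.
by rewrite lerD// dual_norm_ub.
Qed.

Fact dual_norm0_eq0 f : dual_norm f = 0 -> f = 0.
Proof.
move=> f0; apply: dualP => x; apply/eqP; rewrite -normr_le0.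
by apply: le_trans (ler_dual_norm f x) _; rewrite f0 mul0r.
Qed.

Fact dual_normZ_le (c : R) f : dual_norm (c *: f) <= `|c| * dual_norm f.
Proof.
apply: dual_norm_le => x x1.
by rewrite [X in `|X|]/(c *: f x) normrZ ler_wpM2l// dual_norm_ub.
Qed.

Fact dual_normZ (c : R) f : dual_norm (c *: f) = `|c| * dual_norm f.
Proof.
apply/le_anti; rewrite dual_normZ_le/=.
have [->|c0] := eqVneq c 0.
  rewrite normr0 mul0r; have := dual_norm_ub (0 *: f) (x := 0).
  by rewrite normr0 ler01 => /(_ isT); exact: le_trans.
rewrite -ler_pdivlMl ?normr_gt0// -normfV.
by have := dual_normZ_le c^-1 (c *: f); rewrite scalerA mulVf// scale1r.
Qed.

HB.instance Definition _ := Lmodule_isNormed.Build R dual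
  dual_normD dual_normZ dual_norm0_eq0.

End continuous_dual.

Section bases.
Context {R : realType}.

Definition schauder_basis (E : normedModType R) (e : nat -> E) :=
  forall x : E, exists! a : nat -> R, series (fun j => a j *: e j) @ \oo --> x.

(* unconditional constant 1, i.e. invariance of the norm under changes of
   signs of the coordinates *)
Definition one_unconditional (E : normedModType R) (e : nat -> E) :=
  forall (n : nat) (a : nat -> R) (s : nat -> bool),
    `|\sum_(j < n) ((-1) ^+ s j * a j) *: e j| <= `|\sum_(j < n) a j *: e j|.

Record normalized_1unconditional_basis (E : completeNormedModType R) := NUBasis {
  nubasis_seq :> nat -> E;
  nubasis_schauder : schauder_basis nubasis_seq;
  nubasis_norm : forall j, `|nubasis_seq j| = 1;
  nubasis_unconditional : one_unconditional nubasis_seq }.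

Definition biorthogonal (E : normedModType R) (e : nat -> E) (es : nat -> dual E) :=
  forall i j, es i (e j) = (i == j)%:R.

Definition boundedly_complete (V : normedModType R) (v : nat -> V) :=
  forall a : nat -> R,
    bounded_fun (series (fun j => a j *: v j)) ->
    cvgn (series (fun j => a j *: v j)).

End bases.

Section direct_sum.
Context {R : realType} {E : completeNormedModType R}.
Variable e : normalized_1unconditional_basis E.

Lemma nubasis_dominated1 (a b : nat -> R) n k :
  (forall j, j != k -> a j = b j) -> `|a k| <= `|b k| ->
  `|\sum_(j < n) a j *: e j| <= `|\sum_(j < n) b j *: e j|.
Proof.
move=> ab akbk.
have [t /andP[t1 t2] akE] : exists2 t, -1 <= t <= 1 & a k = t * b k.
  have [bk0|bk0] := eqVneq (b k) 0.
    exists 0; first by rewrite lerN10 ler01.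
    by apply/eqP; rewrite mul0r -normr_le0 (le_trans akbk)// bk0 normr0.
  exists (a k / b k); last by rewrite divfK.
  by rewrite -ler_norml normf_div ler_pdivrMr ?mul1r// normr_gt0.
pose s j := j == k.
have -> : \sum_(j < n) a j *: e j =
    ((1 + t) / 2) *: (\sum_(j < n) b j *: e j) +
    ((1 - t) / 2) *: (\sum_(j < n) ((-1) ^+ s j * b j) *: e j).
  rewrite !scaler_sumr -big_split/=; apply: eq_bigr => j _.
  rewrite !scalerA -scalerDl; congr (_ *: _); rewrite /s.
  have [->|/ab ->] := eqVneq (j : nat) k.
    by rewrite akE expr1; field.
  by rewrite expr0; field.
apply: le_trans (ler_normD _ _) _.
have p1 : 0 <= (1 + t) / 2 by rewrite divr_ge0// addrC -lerBlDr sub0r.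
have p2 : 0 <= (1 - t) / 2 by rewrite divr_ge0// subr_ge0.
rewrite (normrZ ((1 + t) / 2)) (normrZ ((1 - t) / 2)) (ger0_norm p1) (ger0_norm p2).
apply: le_trans (lerD (lexx _) (ler_wpM2l p2 (nubasis_unconditional e _ _ _))) _.
by lra.
Qed.

Lemma nubasis_dominated (a b : nat -> R) n :
  (forall j, `|a j| <= `|b j|) ->
  `|\sum_(j < n) a j *: e j| <= `|\sum_(j < n) b j *: e j|.
Proof.
move=> ab; pose c k j := if (j < k)%N then a j else b j.
have ck k : `|\sum_(j < n) c k j *: e j| <= `|\sum_(j < n) b j *: e j|.
  elim: k => [|k]; first by under eq_bigr do rewrite /c ltn0.
  apply: le_trans; apply: (@nubasis_dominated1 _ _ _ k) => [j jk|].
    by rewrite /c ltnS leq_eqVlt (negbTE jk).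
  by rewrite /c ltnS leqnn ltnn.
have := ck n; congr (_ <= _); congr `|_|; apply: eq_bigr => j _.
by rewrite /c ltn_ord.
Qed.

Lemma nubasis_dominated_nat (a b : nat -> R) m n :
  (forall j, `|a j| <= `|b j|) ->
  `|\sum_(m <= j < n) a j *: e j| <= `|\sum_(m <= j < n) b j *: e j|.
Proof.
move=> ab; have h (c : nat -> R) : \sum_(m <= j < n) c j *: e j =
    \sum_(j < n) (if (m <= j)%N then c j else 0) *: e j.
  rewrite (big_nat_widenl m 0)//= big_mkord big_mkcond/=.
  by apply: eq_bigr => j _; case: ifP; rewrite ?scale0r.
rewrite !h; apply: (@nubasis_dominated (fun j => if (m <= j)%N then a j else 0)
  (fun j => if (m <= j)%N then b j else 0)) => j.
by case: ifP.
Qed.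

Lemma nubasis_cvg_dominated (a b : nat -> R) :
  (forall j, `|a j| <= `|b j|) ->
  cvgn (series (fun j => b j *: e j)) -> cvgn (series (fun j => a j *: e j)).
Proof.
move=> ab /cauchy_cvgP/cauchy_seriesP cb; apply/cauchy_cvgP/cauchy_seriesP => r r0.
apply: filterS (cb _ r0) => -[m n] /=; apply: le_lt_trans.
exact: nubasis_dominated_nat.
Qed.

Lemma nubasis_lim_dominated (a b : nat -> R) :
  (forall j, `|a j| <= `|b j|) ->
  cvgn (series (fun j => b j *: e j)) ->
  `|limn (series (fun j => a j *: e j))| <= `|limn (series (fun j => b j *: e j))|.
Proof.
move=> ab cb; have ca := nubasis_cvg_dominated ab cb.
rewrite -!lim_norm//; apply: ler_lim; [exact: is_cvg_norm|exact: is_cvg_norm|].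
by near=> n; rewrite /series/=; exact: nubasis_dominated_nat.
Unshelve. all: by end_near. Qed.

Variable X : nat -> completeNormedModType R.

Record direct_sum := DirectSum {
  dsum_val :> forall n, X n;
  dsum_cvg : cvgn (series (fun n => `|dsum_val n| *: e n)) }.

HB.instance Definition _ := gen_eqMixin direct_sum.
HB.instance Definition _ := gen_choiceMixin direct_sum.

Lemma dsumP (x y : direct_sum) : (forall n, x n = y n) -> x = y.
Proof.
case: x y => [x cx] [y cy] /= xy.
have {}xy : x = y by exact: functional_extensionality_dep.
by subst y; congr DirectSum; exact: Prop_irrelevance.
Qed.

Fact dsum_zero_cvg : cvgn (series (fun n => `|0 : X n| *: e n)).
Proof.
have -> : series (fun n => `|0 : X n| *: e n) = cst 0.
  by apply/funext => n; rewrite /series/= big1// => j _; rewrite normr0 scale0r.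
exact: is_cvg_cst.
Qed.
Definition dsum_zero := DirectSum dsum_zero_cvg.

Fact dsum_opp_cvg (x : direct_sum) : cvgn (series (fun n => `|- x n| *: e n)).
Proof. by under eq_fun do rewrite normrN; exact: dsum_cvg. Qed.
Definition dsum_opp x := DirectSum (@dsum_opp_cvg x).

Lemma dsum_seriesD (x y : direct_sum) :
  series (fun n => (`|x n| + `|y n|) *: e n) =
  series (fun n => `|x n| *: e n) + series (fun n => `|y n| *: e n).
Proof.
apply/funext => n; rewrite /series/= fctE -big_split/=.
by apply: eq_bigr => j _; rewrite scalerDl.
Qed.

Lemma dsum_seriesD_cvg (x y : direct_sum) :
  cvgn (series (fun n => (`|x n| + `|y n|) *: e n)).
Proof. by rewrite dsum_seriesD; apply: is_cvgD; exact: dsum_cvg. Qed.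

Lemma dsum_normD_coord (x y : direct_sum) n :
  `| `|x n + y n| | <= `| `|x n| + `|y n| |.
Proof. by rewrite normr_id ger0_norm ?addr_ge0// ler_normD. Qed.

Fact dsum_add_cvg (x y : direct_sum) :
  cvgn (series (fun n => `|x n + y n| *: e n)).
Proof.
exact: nubasis_cvg_dominated (dsum_normD_coord x y) (@dsum_seriesD_cvg x y).
Qed.
Definition dsum_add x y := DirectSum (@dsum_add_cvg x y).

Lemma dsum_seriesZ (c : R) (x : direct_sum) :
  series (fun n => `|c *: x n| *: e n) =
  `|c| \*: series (fun n => `|x n| *: e n).
Proof.
apply/funext => n; rewrite /series/= scaler_sumr.
by apply: eq_bigr => j _; rewrite normrZ scalerA.
Qed.

Fact dsum_scale_cvg (c : R) (x : direct_sum) :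
  cvgn (series (fun n => `|c *: x n| *: e n)).
Proof. by rewrite dsum_seriesZ; apply: is_cvgZl_tmp; exact: dsum_cvg. Qed.
Definition dsum_scale c x := DirectSum (@dsum_scale_cvg c x).

Fact dsum_addA : associative dsum_add.
Proof. by move=> x y z; apply: dsumP => n /=; rewrite addrA. Qed.
Fact dsum_addC : commutative dsum_add.
Proof. by move=> x y; apply: dsumP => n /=; rewrite addrC. Qed.
Fact dsum_add0 : left_id dsum_zero dsum_add.
Proof. by move=> x; apply: dsumP => n /=; rewrite add0r. Qed.
Fact dsum_addN : left_inverse dsum_zero dsum_opp dsum_add.
Proof. by move=> x; apply: dsumP => n /=; rewrite addNr. Qed.
HB.instance Definition _ :=
  GRing.isZmodule.Build direct_sum dsum_addA dsum_addC dsum_add0 dsum_addN.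

Fact dsum_scaleA a b x : dsum_scale a (dsum_scale b x) = dsum_scale (a * b) x.
Proof. by apply: dsumP => n /=; rewrite scalerA. Qed.
Fact dsum_scale1 : left_id 1 dsum_scale.
Proof. by move=> x; apply: dsumP => n /=; rewrite scale1r. Qed.
Fact dsum_scaleDr : right_distributive dsum_scale +%R.
Proof. by move=> a x y; apply: dsumP => n /=; rewrite scalerDr. Qed.
Fact dsum_scaleDl x : {morph dsum_scale^~ x : a b / a + b}.
Proof. by move=> a b; apply: dsumP => n /=; rewrite scalerDl. Qed.
HB.instance Definition _ := GRing.Zmodule_isLmodule.Build R direct_sum
  dsum_scaleA dsum_scale1 dsum_scaleDr dsum_scaleDl.

Lemma dsum_addE (x y : direct_sum) n : (x + y) n = x n + y n.
Proof. by []. Qed.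
Lemma dsum_scaleE c (x : direct_sum) n : (c *: x) n = c *: x n.
Proof. by []. Qed.

Definition dsum_norm (x : direct_sum) : R :=
  `|limn (series (fun n => `|x n| *: e n))|.

Fact dsum_normD x y : dsum_norm (x + y) <= dsum_norm x + dsum_norm y.
Proof.
apply: le_trans (nubasis_lim_dominated (dsum_normD_coord x y)
  (@dsum_seriesD_cvg x y)) _.
rewrite dsum_seriesD limD; [|exact: dsum_cvg..].
exact: ler_normD.
Qed.

Fact dsum_normZ (c : R) x : dsum_norm (c *: x) = `|c| * dsum_norm x.
Proof.
rewrite /dsum_norm [X in limn X]dsum_seriesZ limZr; last exact: dsum_cvg.
by rewrite normrZ normr_id.
Qed.

Lemma ler_dsum_norm (x : direct_sum) n : `|x n| <= dsum_norm x.
Proof.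
pose a j : R := if j == n then `|x n| else 0.
have ax j : `|a j| <= `| `|x j| |.
  by rewrite /a; case: eqVneq => [->//|_]; rewrite normr0.
have := nubasis_lim_dominated ax (@dsum_cvg x); apply: le_trans.
suff -> : limn (series (fun j => a j *: e j)) = `|x n| *: e n.
  by rewrite normrZ normr_id nubasis_norm mulr1.
apply/cvg_lim => //; apply: cvg_near_cst; exists n.+1 => //= m /= nm.
rewrite /series/= (bigD1_seq n)/= ?mem_index_iota ?iota_uniq//.
rewrite /a eqxx big1 ?addr0// => j /negbTE ->.
by rewrite scale0r.
Qed.

Fact dsum_norm0_eq0 x : dsum_norm x = 0 -> x = 0.
Proof.
move=> x0; apply: dsumP => n; apply/eqP; rewrite -normr_le0 -x0.
exact: ler_dsum_norm.
Qed.

HB.instance Definition _ := Lmodule_isNormed.Build R direct_sum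
  dsum_normD dsum_normZ dsum_norm0_eq0.

Fact dsum_inj_cvg n (x : X n) :
  cvgn (series (fun k => `|eqtype.dfwith (fun i => 0 : X i) x k| *: e k)).
Proof.
apply/cvg_ex; exists (`|x| *: e n); apply: cvg_near_cst.
exists n.+1 => //= m /= nm.
rewrite /series/= (bigD1_seq n)/= ?mem_index_iota ?iota_uniq//.
rewrite dfwith_in big1 ?addr0// => j jn.
by rewrite dfwith_out 1?eq_sym// normr0 scale0r.
Qed.
(* the element of the direct sum with n-th coordinate x and all others 0 *)
Definition dsum_inj n (x : X n) : direct_sum := DirectSum (@dsum_inj_cvg n x).

Lemma dsum_inj_linear n : linear (@dsum_inj n).
Proof.
move=> a x y; apply: dsumP => k; rewrite dsum_addE dsum_scaleE.
rewrite -![dsum_val (dsum_inj _) _]/(eqtype.dfwith _ _ _).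
have [nk|nk] := eqVneq n k; first by subst k; rewrite !eqtype.dfwith_in.
by rewrite !eqtype.dfwith_out// scaler0 addr0.
Qed.

Lemma dsum_norm_inj n (x : X n) : `|dsum_inj x| = `|x|.
Proof.
rewrite [LHS]/(dsum_norm _) /dsum_norm.
suff -> : limn (series (fun k => `|dsum_inj x k| *: e k)) = `|x| *: e n.
  by rewrite normrZ normr_id nubasis_norm mulr1.
apply/cvg_lim => //; apply: cvg_near_cst.
exists n.+1 => //= m /= nm.
rewrite /series/= (bigD1_seq n)/= ?mem_index_iota ?iota_uniq//.
rewrite eqtype.dfwith_in big1 ?addr0// => j jn.
by rewrite eqtype.dfwith_out 1?eq_sym// normr0 scale0r.
Qed.

(* T_n = T restricted to X_n *)
Definition dsum_restr (Z : Type) (T : direct_sum -> Z) n : X n -> Z :=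
  fun x => T (dsum_inj x).

End direct_sum.

Arguments dsum_restr {R E e X Z} T n x.

Section lattice_constants.
Context {R : realType}.

Definition lp_norm (p : \bar R) n (a : 'I_n -> R) : R :=
  match p with
  | r%:E => (\sum_(i < n) `|a i| `^ r) `^ r^-1
  | _ => \big[Num.max/0]_(i < n) `|a i|
  end.

Context {V : normedModType R}.
Variable le : V -> V -> Prop.

Definition is_lattice_sup (A : set V) (y : V) :=
  (forall x, A x -> le x y) /\
  (forall z, (forall x, A x -> le x z) -> le y z).

(* y = (sum_i |x_i|^p)^(1/p): in a Banach lattice this element is the supremum
   of the sum_i a_i x_i over the unit ball of l_(p')^n; for p = +oo it is the
   supremum of the |x_i| *)
Definition is_lattice_lp (p : \bar R) n (x : 'I_n -> V) (y : V) :=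
  is_lattice_sup
    [set \sum_(i < n) a i *: x i
      | a in [set a : 'I_n -> R | lp_norm (hoelder_conjugate p) a <= 1]] y.

Definition convexity_bound (p : \bar R) (K : R) :=
  0 <= K /\ forall n (x : 'I_n -> V) (y : V), is_lattice_lp p x y ->
    `|y| <= K * lp_norm p (fun i => `|x i|).

Definition concavity_bound (q : \bar R) (K : R) :=
  0 <= K /\ forall n (x : 'I_n -> V) (y : V), is_lattice_lp q x y ->
    lp_norm q (fun i => `|x i|) <= K * `|y|.

Definition convex_lattice p := exists K, convexity_bound p K.
Definition concave_lattice q := exists K, concavity_bound q K.

(* +oo when the lattice is not p-convex (resp. not q-concave) *)
Definition convexity_constant p : \bar R :=
  ereal_inf [set K%:E | K in convexity_bound p].
Definition concavity_constant q : \bar R :=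
  ereal_inf [set K%:E | K in concavity_bound q].

End lattice_constants.

Section lattice_orders.
Context {R : realType} {E : normedModType R}.

Definition coordinate_le (es : nat -> dual E) (x y : E) : Prop :=
  forall j, (es j x : R) <= es j y.

Definition dual_le (le : E -> E -> Prop) (f g : dual E) : Prop :=
  forall x, le 0 x -> (f x : R) <= g x.

End lattice_orders.

Section summing.
Context {R : realType} {V W : normedModType R}.

Definition weak_lp_norm (p : \bar R) n (x : 'I_n -> V) : R :=
  sup [set lp_norm p (fun i => f (x i)) | f in [set f : dual V | `|f| <= 1]].

Definition summing_bound (p : \bar R) (T : V -> W) (C : R) :=
  0 <= C /\
  match p with
  | +oo%E => forall x, `|T x| <= C * `|x|
  | _ => forall n (x : 'I_n -> V),
      lp_norm p (fun i => `|T (x i)|) <= C * weak_lp_norm p x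
  end.

Definition summing p (T : V -> W) := exists C, summing_bound p T C.

(* +oo when T is not p-summing *)
Definition summing_norm p (T : V -> W) : \bar R :=
  ereal_inf [set C%:E | C in summing_bound p T].

End summing.

Section summing_restr.
Context {R : realType} {E : completeNormedModType R}.
Context {e : normalized_1unconditional_basis E}.
Context {X : nat -> completeNormedModType R} {Z : normedModType R}.

HB.instance Definition _ n :=
  GRing.isLinear.Build R (X n) (direct_sum e X) *:%R (@dsum_inj _ _ e X n)
    (@dsum_inj_linear _ _ e X n).

Lemma lp_norm_le p n (a b : 'I_n -> R) : (0 < p)%E ->
  (forall i, `|a i| <= `|b i|) -> lp_norm p a <= lp_norm p b.
Proof.
case: p => [r|_|//] /=; last by move=> ab; exact: le_bigmax2.
rewrite lte_fin => r0 ab; rewrite ge0_ler_powR ?invr_ge0 ?(ltW r0)// ?nnegrE.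
- by rewrite sumr_ge0// => i _; exact: powR_ge0.
- by rewrite sumr_ge0// => i _; exact: powR_ge0.
- by apply: ler_sum => i _; rewrite ge0_ler_powR ?(ltW r0)// nnegrE.
Qed.

Lemma weak_lp_norm_has_ub (V : normedModType R) p n (x : 'I_n -> V) : (0 < p)%E ->
  has_ubound [set lp_norm p (fun i => f (x i)) | f in [set f : dual V | `|f| <= 1]].
Proof.
move=> p0; exists (lp_norm p (fun i => `|x i|)) => _ [f /= f1 <-].
apply: lp_norm_le => // i; rewrite normr_id.
by apply: le_trans (ler_dual_norm f (x i)) _; rewrite ler_piMl.
Qed.

Lemma weak_lp_norm_inj p n m (x : 'I_m -> X n) : (0 < p)%E ->
  weak_lp_norm p (fun i => dsum_inj e (x i)) <= weak_lp_norm p x.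
Proof.
move=> p0; apply: ge_sup.
  exists (lp_norm p (fun i => (0 : dual (direct_sum e X)) (dsum_inj e (x i)))).
  by exists 0 => //=; rewrite normr0.
move=> _ [f /= f1 <-]; apply: ub_le_sup; first exact: weak_lp_norm_has_ub.
have fl : linear (fun y : X n => f (dsum_inj e y)).
  by move=> a y z; rewrite !linearP.
have fc : continuous (fun y : X n => f (dsum_inj e y)).
  pose g := HB.pack_for {linear X n -> R^o} (fun y : X n => f (dsum_inj e y))
    (GRing.isLinear.Build _ _ _ _ _ fl).
  apply: (@bounded_linear_continuous _ _ _ g).
  apply/linear_boundedP; exists `|f|; split; first exact: num_real.
  move=> r fr y; apply: le_trans (ler_dual_norm f _) _.
  by rewrite dsum_norm_inj ler_wpM2r// ltW.
exists (Dual fl fc) => //=; apply: dual_norm_le => y y1 /=.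
apply: le_trans (ler_dual_norm f _) _; rewrite dsum_norm_inj.
by apply: le_trans _ f1; rewrite ler_piMr//; exact: normr_ge0 f.
Qed.

Lemma summing_norm_restr_le p (T : direct_sum e X -> Z) n : (0 < p)%E ->
  (summing_norm p (dsum_restr T n) <= summing_norm p T)%E.
Proof.
move=> p0; apply: ereal_inf_le_tmp => _ [C [C0 TC] <-]; exists C => //; split => //.
case: p p0 TC => [r||//] p0 TC.
- move=> m x; apply: le_trans (TC m (fun i => dsum_inj e (x i))) _.
  by rewrite ler_wpM2l// weak_lp_norm_inj.
- by move=> x; apply: le_trans (TC _) _; rewrite dsum_norm_inj.
Qed.

End summing_restr.

(* Main.v *)
From HB Require Import structures.
Require Import Defs.
From mathcomp Require Import all_boot all_order all_algebra.
From mathcomp Require Import all_classical all_reals all_analysis.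
From mathcomp Require Import ring lra.
Import Order.TTheory GRing.Theory Num.Theory.
Import numFieldNormedType.Exports.
Set Implicit Arguments.
Unset Strict Implicit.
Unset Printing Implicit Defensive.
Local Open Scope classical_set_scope.
Local Open Scope ring_scope.

(** Let a_j = pi_p(T_j), p < oo.  Concatenating families in the X_j that almost
    attain a_j, weighted by l_j^(1/p), gives sum_j l_j a_j^p <= pi_p(T)^p as soon
    as sum_j l_j |g(e_j)|^p <= |g|^p for all g in E^*, because the restrictions
    f_j to X_j of a functional f on the direct sum satisfy
    |sum_j |f_j| e_j^*| <= |f|.  By Hahn-Banach in R^m these weights compute, at
    (a_j^p)_j, the convexification of b |-> |sum_j b_j^(1/p) e_j^*|^p, and
    p-convexity says that the latter is at most K^p times its convexification.
    For p = oo it suffices to apply p-convexity to the functionals a_j e_j^*.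
    Concavity of E and convexity of E^* are exchanged by the l_p-l_p' duality,
    after truncation to finitely many coordinates.  When T is the sum of the T_n
    in the p-summing norm, the estimate applied to the tails of this series
    shows that the partial sums are Cauchy. *)

(** * Duality of the [l_p] norms on finite families *)

Section lp_duality.
Context {R : realType}.
Implicit Types (r s : R) (p : \bar R).

Lemma hoelder_conjugate_cases p : (1 <= p)%E ->
  [\/ p = 1%E /\ hoelder_conjugate p = +oo%E,
      p = +oo%E /\ hoelder_conjugate p = 1%E |
      exists r s, [/\ p = r%:E, hoelder_conjugate p = s%:E, 1 < r, 0 < s &
        r^-1 + s^-1 = 1] ].
Proof.
move=> p1; case: (eqVneq p 1%E) => [->|pn1].
  by constructor 1; rewrite hoelder_conjugate1.
case: p p1 pn1 => [r r1 rn1| _ _|//]; last by constructor 2.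
constructor 3; have {rn1}r1 : 1 < r.
  by rewrite lt_neqAle -lee_fin r1 andbT eq_sym -eqe.
have r0 : r != 0 by rewrite gt_eqF// (lt_trans ltr01).
have rm0 : r - 1 != 0 by rewrite subr_eq0 gt_eqF.
exists r, (r / (r - 1)); split=> //.
- by rewrite /hoelder_conjugate/= eqe (negbTE r0) -EFinB inver (negbTE rm0).
- by rewrite divr_gt0 ?subr_gt0// (lt_trans ltr01).
- by field; rewrite rm0 r0.
Qed.

Lemma lp_norm_ge0 p n (a : 'I_n -> R) : 0 <= lp_norm p a.
Proof.
have mx : 0 <= \big[Num.max/0]_(i < n) `|a i|.
  by elim/big_ind : _ => // x y x0 y0; rewrite le_max x0.
by case: p => [r||//] /=; rewrite ?powR_ge0.
Qed.

Lemma lp_norm1 n (a : 'I_n -> R) : lp_norm 1%E a = \sum_(i < n) `|a i|.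
Proof.
rewrite /= invr1 powRr1; last by apply: sumr_ge0 => i _; exact: powR_ge0.
by apply: eq_bigr => i _; rewrite powRr1.
Qed.

Lemma lp_norm_coord p n (a : 'I_n -> R) i : (0 < p)%E -> `|a i| <= lp_norm p a.
Proof.
case: p => [r||//]; last by move=> _; exact: le_bigmax.
rewrite lte_fin => r0 /=.
rewrite -[leLHS](@powRr1 _ `|a i|)// -(@divff _ r) ?gt_eqF// powRrM.
rewrite ge0_ler_powR ?invr_ge0 ?(ltW r0)// ?nnegrE ?powR_ge0//.
  by rewrite sumr_ge0// => j _; exact: powR_ge0.
rewrite (bigD1 i)//= lerDl sumr_ge0// => j _; exact: powR_ge0.
Qed.

Lemma lp_norm_powR r n (a : 'I_n -> R) : 0 < r ->
  lp_norm r%:E a `^ r = \sum_(i < n) `|a i| `^ r.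
Proof.
move=> r0; rewrite /= -powRrM mulVf ?gt_eqF// powRr1//.
by apply: sumr_ge0 => i _; exact: powR_ge0.
Qed.

Lemma le_powR_inv r (x y : R) : 0 < r -> 0 <= x -> 0 <= y ->
  (x <= y `^ r^-1) = (x `^ r <= y).
Proof.
move=> r0 x0 y0; apply/idP/idP => h.
  have := @ge0_ler_powR _ r (ltW r0) x (y `^ r^-1).
  rewrite !nnegrE powR_ge0 -powRrM mulVf ?gt_eqF// powRr1//; exact.
have := @ge0_ler_powR _ r^-1 _ (x `^ r) y.
rewrite invr_ge0 ltW// !nnegrE powR_ge0 -powRrM divff ?gt_eqF// powRr1//.
exact.
Qed.

Lemma lp_normZ p n (a : 'I_n -> R) t : (0 < p)%E -> 0 <= t ->
  lp_norm p (fun i => a i * t) = lp_norm p a * t.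
Proof.
move=> p0 t0; case: p p0 => [r||//]; last first.
  move=> _ /=; have := @lp_norm_ge0 +oo%E n a; rewrite /= => m0.
  apply: (big_ind2 (fun x y : R => x = y * t)) => [|x u y v -> ->|i _].
  - by rewrite mul0r.
  - by rewrite maxr_pMl.
  - by rewrite normrM (ger0_norm t0).
rewrite lte_fin => r0 /=.
under eq_bigr do rewrite normrM (ger0_norm t0) powRM//.
rewrite -mulr_suml powRM ?powR_ge0//; last first.
  by apply: sumr_ge0 => i _; exact: powR_ge0.
by rewrite -powRrM divff ?gt_eqF// powRr1.
Qed.

Lemma lp_norm0 p n : (0 < p)%E -> lp_norm p (fun _ : 'I_n => 0) = 0.
Proof.
move=> p0; have := @lp_normZ p n (fun=> 0) 0 p0 (lexx 0).
by under eq_fun do rewrite mulr0; rewrite mulr0.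
Qed.

Lemma eq_lp_norm p n (a b : 'I_n -> R) : a =1 b -> lp_norm p a = lp_norm p b.
Proof. by move=> /funext ->. Qed.

Lemma powR_div t (x y : R) : 0 <= x -> 0 < y ->
  (x / y) `^ t = x `^ t / y `^ t.
Proof.
move=> x0 y0; rewrite powRM ?invr_ge0 ?(ltW y0)//; congr (_ * _).
by rewrite -powR_inv1 ?(ltW y0)// -powRrM mulN1r powRN.
Qed.

(** Young's inequality is applied to [|a_i| / A] and [|b_i| / B]; summed over i, its right-hand side
    is 1/s + 1/r = 1. *)
Lemma sum_hoelder r s n (a b : 'I_n -> R) (A B : R) : 0 < r -> 0 < s ->
  r^-1 + s^-1 = 1 -> 0 < A -> 0 < B ->
  A `^ s = \sum_(i < n) `|a i| `^ s -> B `^ r = \sum_(i < n) `|b i| `^ r ->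
  \sum_(i < n) `|a i| * `|b i| <= A * B.
Proof.
move=> r0 s0 rs Ap Bp AE BE.
rewrite -[leRHS]mul1r -ler_pdivrMr ?mulr_gt0// mulr_suml.
have young i : `|a i| * `|b i| / (A * B) <=
    `|a i| `^ s * (A `^ s)^-1 / s + `|b i| `^ r * (B `^ r)^-1 / r.
  have -> : `|a i| * `|b i| / (A * B) = (`|a i| / A) * (`|b i| / B).
    by field; rewrite !gt_eqF.
  rewrite -!powR_div//; apply: conjugate_powR => //; last by rewrite addrC.
  - by rewrite divr_ge0// ltW.
  - by rewrite divr_ge0// ltW.
apply: le_trans (ler_sum _ (fun i _ => young i)) _.
have A's : A `^ s != 0 by rewrite gt_eqF// powR_gt0.
have B'r : B `^ r != 0 by rewrite gt_eqF// powR_gt0.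
by rewrite big_split/= -!mulr_suml -AE -BE !divff// !mul1r addrC rs.
Qed.

Lemma lp_hoelder_conj r s n (a b : 'I_n -> R) : 0 < r -> 0 < s ->
  r^-1 + s^-1 = 1 ->
  \sum_(i < n) `|a i| * `|b i| <= lp_norm s%:E a * lp_norm r%:E b.
Proof.
move=> r0 s0 rs.
have coord0 t (c : 'I_n -> R) : 0 < t -> lp_norm t%:E c = 0 ->
    forall i, `|c i| = 0.
  move=> t0 c0 i; apply/le_anti; rewrite normr_ge0 andbT -c0.
  by apply: lp_norm_coord; rewrite lte_fin.
have [A0|A0] := eqVneq (lp_norm s%:E a) 0.
  rewrite big1 => [|i _]; first by rewrite mulr_ge0// lp_norm_ge0.
  by rewrite (coord0 _ _ s0 A0) mul0r.
have [B0|B0] := eqVneq (lp_norm r%:E b) 0.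
  rewrite big1 => [|i _]; first by rewrite mulr_ge0// lp_norm_ge0.
  by rewrite (coord0 _ _ r0 B0) mulr0.
apply: sum_hoelder r0 s0 rs _ _ (lp_norm_powR a s0) (lp_norm_powR b r0).
- by rewrite lt0r A0 lp_norm_ge0.
- by rewrite lt0r B0 lp_norm_ge0.
Qed.

Lemma lp_hoelder1 n (a b : 'I_n -> R) :
  \sum_(i < n) `|a i| * `|b i| <= lp_norm +oo%E a * lp_norm 1%E b.
Proof.
rewrite lp_norm1 mulr_sumr ler_sum// => i _; rewrite ler_wpM2r//.
by have := @lp_norm_coord +oo%E n a i; apply.
Qed.

Lemma lp_hoelder p n (a b : 'I_n -> R) : (1 <= p)%E ->
  \sum_(i < n) `|a i| * `|b i| <=
    lp_norm (hoelder_conjugate p) a * lp_norm p b.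
Proof.
move=> /hoelder_conjugate_cases[[-> ->]|[-> ->]|[r [s [-> -> r1 s0 rs]]]].
- exact: lp_hoelder1.
- rewrite [leRHS]mulrC; under eq_bigr do rewrite mulrC.
  exact: lp_hoelder1.
- by apply: lp_hoelder_conj => //; rewrite (lt_trans ltr01).
Qed.

(** The equality case of Hölder's inequality: signs for p = 1, a signed unit vector at a largest
    coordinate for p = +oo, and signed powers of exponent r - 1 in between. Attainment turns the
    suprema in [is_lattice_lp] into [l_p] norms of coordinates. *)
Lemma lp_norm_attained p n (b : 'I_n -> R) : (1 <= p)%E ->
  exists2 a : 'I_n -> R, lp_norm (hoelder_conjugate p) a <= 1 &
    \sum_(i < n) a i * b i = lp_norm p b.
Proof.
move=> /hoelder_conjugate_cases[[-> ->]|[-> ->]|[r [s [-> -> r1 s0 rs]]]].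
- exists (fun i => Num.sg (b i)).
    by apply/bigmax_leP; split=> // i _; rewrite normr_sg; case: (_ != _).
  by rewrite lp_norm1; apply: eq_bigr => i _; rewrite normrEsg.
(* An empty family has no largest coordinate, so n = 0 is treated apart. *)
- case: n b => [|n] b.
    by exists (fun=> 0); rewrite ?lp_norm1/= !big_ord0.
  have [i _ iE] : {i | true & lp_norm +oo%E b = `|b i|}.
    by apply: eq_bigmax => //; exact: ord0.
  exists (fun k => if k == i then Num.sg (b i) else 0).
    rewrite lp_norm1 (bigD1 i)//= eqxx big1 => [|k /negbTE ->]; last first.
      by rewrite normr0.
    by rewrite addr0 normr_sg; case: (_ != _).
  rewrite iE (bigD1 i)//= eqxx big1 => [|k /negbTE ->]; last by rewrite mul0r.
  by rewrite addr0 -normrEsg.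
- have r0 : 0 < r by rewrite (lt_trans ltr01).
  have BE := lp_norm_powR b r0.
  have [B0|B0] := eqVneq (lp_norm r%:E b) 0.
    exists (fun=> 0); last by rewrite B0 big1// => i _; rewrite mul0r.
    rewrite /= big1 ?powR0 ?invr_eq0 ?gt_eqF// => i _.
    by rewrite normr0 powR0// gt_eqF.
  have {B0}Bp : 0 < lp_norm r%:E b by rewrite lt0r B0 lp_norm_ge0.
  move: (lp_norm r%:E b) BE Bp => B BE Bp.
  have Br : 0 < B `^ r by rewrite powR_gt0.
  have Br1 : 0 < B `^ (r - 1) by rewrite powR_gt0.
  (* Since (r - 1) s = r, the s-th powers of this family sum to at most the sum of |b_i|^r / B^r,
     which is 1. *)
  exists (fun i => Num.sg (b i) * (`|b i| `^ (r - 1) / B `^ (r - 1))).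
    rewrite /= -[leRHS](congr1 (@^~ s^-1) (powR1 R)).
    rewrite ge0_ler_powR ?invr_ge0 ?(ltW s0)// ?nnegrE//.
      by rewrite sumr_ge0// => i _; exact: powR_ge0.
    rewrite [leRHS](_ : 1 = \sum_(i < n) `|b i| `^ r / B `^ r); last first.
      by rewrite -mulr_suml -BE divff// gt_eqF.
    apply: ler_sum => i _; rewrite normrM normr_sg.
    have [->|bi0] := eqVneq (b i) 0.
      rewrite mul0r powR0 ?gt_eqF// divr_ge0 ?powR_ge0//.
    rewrite mul1r ger0_norm ?divr_ge0 ?powR_ge0// powR_div ?powR_ge0//.
    have {Br Br1 BE} sr : (r - 1) * s = r.
      have := rs.
      have rn : r != 0 by rewrite gt_eqF.
      have sn : s != 0 by rewrite gt_eqF.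
      move=> /(congr1 ( *%R (r * s))); rewrite mulrDr mulr1 => h.
      have {h} : s + r = r * s by rewrite -h; field; rewrite rn sn.
      by move=> h; rewrite mulrBl -h mul1r; ring.
    by rewrite -!powRrM sr.
  have BB : B = B `^ r / B `^ (r - 1).
    by rewrite -mulr_powRB1 ?(ltW Bp)// mulfK// gt_eqF.
  rewrite [RHS]BB BE mulr_suml; apply: eq_bigr => i _.
  have -> : `|b i| `^ r = Num.sg (b i) * b i * `|b i| `^ (r - 1).
    by rewrite -normrEsg mulr_powRB1.
  by ring.
Qed.

End lp_duality.

(** * Hahn-Banach extension below a sublinear functional *)

Section sublinear.
Context {R : realType} {W : lmodType R}.

Variable rho : W -> R.
Hypothesis rhoD : forall x y, rho (x + y) <= rho x + rho y.
Hypothesis rhoZ : forall t x, 0 <= t -> rho (t *: x) = t * rho x.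

Lemma sublinear0 : rho 0 = 0.
Proof. by rewrite -[0](scale0r (0 : W)) rhoZ// mul0r. Qed.

(** Induction on m, each step being the one-dimensional Hahn-Banach extension. Domination is stated
    for coefficients, so that linear relations among y and the v_j raise no question of
    well-definedness. *)
Lemma sublinear_extension y m (v : nat -> W) : exists c : nat -> R,
  forall (t : R) (a : nat -> R), t * rho y + \sum_(j < m) a j * c j <=
    rho (t *: y + \sum_(j < m) a j *: v j).
Proof.
elim: m => [|m [c cP]].
  exists (fun=> 0) => t a; rewrite !big_ord0 !addr0.
  have [t0|t0] := leP 0 t; first by rewrite rhoZ.
  have := rhoD (t *: y) (- t *: y).
  have -> : rho (- t *: y) = - t * rho y by rewrite rhoZ// oppr_ge0 ltW.
  by rewrite -scalerDl subrr scale0r sublinear0 mulNr subr_ge0.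
pose L t (a : nat -> R) := t * rho y + \sum_(j < m) a j * c j.
pose u t (a : nat -> R) := t *: y + \sum_(j < m) a j *: v j.
have LZ k t a : L (k * t) (fun j => k * a j) = k * L t a.
  by rewrite /L mulrDr mulr_sumr mulrA; under eq_bigr do rewrite -mulrA.
have uZ k t a : u (k * t) (fun j => k * a j) = k *: u t a.
  by rewrite /u scalerDr scaler_sumr scalerA; under eq_bigr do rewrite -scalerA.
pose S := [set z | exists t a, z = L t a - rho (u t a - v m)].
(* Every lower bound for the new value lies below every upper bound: u + u' = (u' + v_m) + (u -
   v_m), and rho is subadditive. *)
have SP t a t' a' : L t a - rho (u t a - v m) <= rho (u t' a' + v m) - L t' a'.
  rewrite lerBrDr addrAC lerBlDr.
  apply: (@le_trans _ _ (rho (u t a + u t' a'))); last first.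
    have -> : u t a + u t' a' = (u t' a' + v m) + (u t a - v m).
      by rewrite [RHS]addrACA subrr addr0 addrC.
    exact: rhoD.
  have := cP (t + t') (fun j => a j + a' j).
  under eq_bigr do rewrite mulrDl.
  under [X in rho (_ + X)]eq_bigr do rewrite scalerDl.
  rewrite !big_split/= scalerDl mulrDl => h.
  by rewrite /L /u addrACA (addrACA (_ *: y)).
have Ssup : has_sup S.
  split; first by exists (L 0 (fun=> 0) - rho (u 0 (fun=> 0) - v m)), 0, (fun=> 0).
  exists (rho (u 0 (fun=> 0) + v m) - L 0 (fun=> 0)) => _ [t [a ->]]; exact: SP.
have supl t a : L t a - sup S <= rho (u t a - v m).
  rewrite lerBlDr addrC -lerBlDr; apply: ub_le_sup; first by case: Ssup.
  by exists t, a.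
have supr t a : L t a + sup S <= rho (u t a + v m).
  rewrite addrC -lerBrDr; apply: ge_sup; first by case: Ssup.
  by move=> _ [t' [a' ->]]; exact: SP.
exists (fun j => if (j < m)%N then c j else sup S) => t a.
rewrite !big_ord_recr/= ltnn; under eq_bigr do rewrite ltn_ord.
rewrite !addrA -/(L t a) -/(u t a).
(* Division by |a_m| reduces a nonzero last coefficient to 1 or -1, the cases settled by [supr] and
   [supl]. *)
have [k0|k0|->] := ltgtP (a m) 0; last by rewrite mul0r scale0r !addr0; exact: cP.
- have nk0 : 0 < - a m by rewrite oppr_gt0.
  have := supl ((- a m)^-1 * t) (fun j => (- a m)^-1 * a j).
  rewrite LZ uZ -(ler_pM2l nk0) -rhoZ ?(ltW nk0)// mulrBr scalerBr scalerA mulrA.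
  by rewrite divff ?gt_eqF// mul1r scale1r mulNr opprK scaleNr opprK.
- have := supr ((a m)^-1 * t) (fun j => (a m)^-1 * a j).
  rewrite LZ uZ -(ler_pM2l k0) -rhoZ ?(ltW k0)// mulrDr scalerDr scalerA mulrA.
  by rewrite divff ?gt_eqF// mul1r scale1r.
Qed.

(* Hahn-Banach for the pullback of [rho] to finitely many coordinates. *)
Lemma sublinear_minorant m (v : nat -> W) (b : nat -> R) :
  exists c : nat -> R,
    (forall a : nat -> R,
       \sum_(j < m) a j * c j <= rho (\sum_(j < m) a j *: v j)) /\
    \sum_(j < m) b j * c j = rho (\sum_(j < m) b j *: v j).
Proof.
set y := \sum_(j < m) b j *: v j.
have [c cP] := sublinear_extension y m v.
exists c; split=> [a|]; first by have := cP 0 a; rewrite mul0r scale0r !add0r.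
apply/le_anti; have := cP 0 b; rewrite mul0r scale0r !add0r => -> /=.
(* The coefficients 1 and -b represent y - y, which bounds rho y minus the sum of the b_j c_j by rho
   0 = 0. *)
have := cP 1 (fun j => - b j); rewrite mul1r scale1r.
under [X in _ + X <= _ -> _]eq_bigr do rewrite mulNr.
under [X in rho (_ + X)]eq_bigr do rewrite scaleNr.
by rewrite !sumrN -/y subrr sublinear0 subr_le0.
Qed.

End sublinear.

(** * Evaluation and norm estimates for bounded functionals *)

Section dual_facts.
Context {R : realType} {V : normedModType R}.

Lemma dual_sumE (I : Type) (s : seq I) (P : pred I) (F : I -> dual V) x :
  (\sum_(i <- s | P i) F i) x = \sum_(i <- s | P i) (F i x : R).
Proof.
by apply: (big_morph (fun f : dual V => f x : R)).
Qed.

Lemma dual_scale_mul c (f : dual V) x : (c *: f) x = c * f x :> R.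
Proof. by []. Qed.

Lemma dualZ (f : dual V) c x : f (c *: x) = c * f x :> R.
Proof. by rewrite linearZ. Qed.

Lemma ler_dual (f : dual V) x : `|f x| <= `|f| * `|x|.
Proof. exact: ler_dual_norm. Qed.

Lemma dual_norm_leP (f : dual V) M : 0 <= M ->
  (forall x, `|f x| <= M * `|x|) -> `|f| <= M.
Proof.
move=> M0 fM; apply: dual_norm_le => x x1; apply: le_trans (fM x) _.
by rewrite ler_piMr.
Qed.

Lemma bounded_linear_dual (f : V -> R) (M : R) :
  (forall a x y, f (a *: x + y) = a * f x + f y) ->
  (forall x, `|f x| <= M * `|x|) -> exists g : dual V, forall x, g x = f x.
Proof.
move=> fl fM; have fl' : linear (f : V -> R^o) by move=> a x y; rewrite fl.
suff fc : continuous (f : V -> R^o) by exists (Dual fl' fc).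
pose g := HB.pack_for {linear V -> R^o} (f : V -> R^o)
  (GRing.isLinear.Build _ _ _ _ _ fl').
apply: (@bounded_linear_continuous _ _ _ g).
apply/linear_boundedP; exists M; split; first exact: num_real.
move=> r fr x; apply: le_trans (fM x) _.
by rewrite ler_wpM2r// ltW.
Qed.

End dual_facts.

(** * Coordinates and domination for the basis and its biorthogonal system *)

Section unconditional_basis.
Context {R : realType} {E : completeNormedModType R}.
Variables (e : normalized_1unconditional_basis E) (es : nat -> dual E).
Hypothesis es_biorth : biorthogonal e es.

Lemma dual_coord_sum (f : dual E) m (a : nat -> R) :
  f (\sum_(j < m) a j *: e j) = \sum_(j < m) a j * f (e j) :> R.
Proof. by rewrite linear_sum; apply: eq_bigr => j _; rewrite linearZ. Qed.

Lemma sum_coord j m (a : nat -> R) :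
  es j (\sum_(k < m) a k *: e k) = (if (j < m)%N then a j else 0) :> R.
Proof.
rewrite dual_coord_sum; case: ltnP => jm.
  rewrite (bigD1 (Ordinal jm))//= es_biorth eqxx mulr1 big1 ?addr0// => k kj.
  by rewrite es_biorth eq_sym -val_eqE in kj *; rewrite (negbTE kj) mulr0.
rewrite big1// => k _; rewrite es_biorth gtn_eqF ?mulr0//.
exact: leq_trans (ltn_ord k) jm.
Qed.

Lemma dual_sum_basis j m (b : nat -> R) :
  (\sum_(k < m) b k *: es k) (e j) = (if (j < m)%N then b j else 0) :> R.
Proof.
rewrite dual_sumE; under eq_bigr do rewrite dual_scale_mul es_biorth.
case: ltnP => jm.
  rewrite (bigD1 (Ordinal jm))//= eqxx mulr1 big1 ?addr0// => k kj.
  by rewrite -val_eqE in kj; rewrite (negbTE kj) mulr0.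
rewrite big1// => k _; rewrite ltn_eqF ?mulr0//.
exact: leq_trans (ltn_ord k) jm.
Qed.

(** Continuity of [es j] along the Schauder expansion identifies its coefficients: the values at the
    partial sums are constant from index j + 1 on. *)
Lemma coord_cvg x : (\sum_(j < n) es j x *: e j) @[n --> \oo] --> x.
Proof.
have [a [ax _]] := nubasis_schauder e x.
suff aE j : es j x = a j.
  suff -> : (fun n => \sum_(j < n) es j x *: e j) =
    series (fun j => a j *: e j) by [].
  apply/funext => n; rewrite /series/= big_mkord.
  by apply: eq_bigr => j _; rewrite aE.
have : es j (series (fun j => a j *: e j) n) @[n --> \oo] --> (es j x : R).
  exact: (continuous_cvg _ (@dual_continuous _ _ (es j) x) ax).
move=> /cvg_lim <-//; apply: cvg_lim => //.
apply: cvg_near_cst; exists j.+1 => //= n /= jn.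
by rewrite /series/= big_mkord sum_coord jn.
Qed.

Lemma dual_cvg (f : dual E) x :
  (\sum_(j < n) es j x * f (e j)) @[n --> \oo] --> (f x : R).
Proof.
have : f (\sum_(j < n) es j x *: e j) @[n --> \oo] --> (f x : R).
  exact: (continuous_cvg _ (@dual_continuous _ _ f x) (@coord_cvg x)).
suff -> : (fun n => f (\sum_(j < n) es j x *: e j) : R) =
  (fun n => \sum_(j < n) es j x * f (e j)) by [].
by apply/funext => n; exact: (dual_coord_sum f n (fun j => es j x)).
Qed.

(** With a extended by zero, domination between finite sums passes to the limit in the expansion of
    x. *)
Lemma coord_dominated m x (a : nat -> R) :
  (forall j, (j < m)%N -> `|a j| <= `|es j x|) ->
  `|\sum_(j < m) a j *: e j| <= `|x|.
Proof.
move=> ax; have /cvg_norm xcvg := @coord_cvg x.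
have <- := cvg_lim (@Rhausdorff R) xcvg.
apply: limr_ge; first by apply/cvg_ex; exists `|x|.
exists m => //= n /= mn.
have -> : \sum_(j < m) a j *: e j =
    \sum_(j < n) (if (j < m)%N then a j else 0) *: e j.
  rewrite (big_ord_widen n (fun j => a j *: e j))// big_mkcond/=.
  by apply: eq_bigr => j _; case: ifP; rewrite ?scale0r.
pose b j : R := if (j < m)%N then a j else 0.
apply: (@nubasis_dominated _ _ e b (fun j => es j x)) => j.
by rewrite /b; case: ifP => [/ax//|_]; rewrite normr0.
Qed.

Lemma coord_norm_le j x : `|es j x| <= `|x|.
Proof.
pose a k : R := if k == j then es j x else 0.
have := @coord_dominated j.+1 x a; rewrite big_ord_recr/= big1 => [|k _].
  rewrite add0r /a eqxx normrZ nubasis_norm mulr1; apply => k _.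
  by case: eqVneq => [->//|_]; rewrite normr0.
by rewrite /a ltn_eqF ?ltn_ord// scale0r.
Qed.

Lemma dual_coord_norm_le j : `|es j| <= 1.
Proof. by apply: dual_norm_leP => // x; rewrite mul1r coord_norm_le. Qed.

(** For a given x, the vector with coordinates sg(f(e_j)) |es_j x|, j < m, has norm at most |x|, and
    f takes on it the value sum_j |f(e_j)| |es_j x|. *)
Lemma dual_dominated (f : dual E) m (b : nat -> R) :
  (forall j, (j < m)%N -> `|b j| <= `|f (e j)|) ->
  `|\sum_(j < m) b j *: es j| <= `|f|.
Proof.
move=> bf; apply: dual_norm_leP => // x; rewrite dual_sumE.
apply: le_trans (ler_norm_sum _ _ _) _.
pose a j : R := Num.sg (f (e j)) * `|es j x|.
apply: (@le_trans _ _ (f (\sum_(j < m) a j *: e j))).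
  rewrite dual_coord_sum; apply: ler_sum => j _.
  rewrite dual_scale_mul normrM /a mulrAC -normrEsg.
  by rewrite ler_wpM2r// bf.
apply: le_trans (ler_norm _) _; apply: le_trans (ler_dual _ _) _.
rewrite ler_wpM2l//; apply: coord_dominated => j _.
by rewrite normrM normr_id normr_sg; case: (_ != _); rewrite ?mul1r// mul0r.
Qed.

(** Each e_j is positive; conversely, on a positive x both functionals are limits of combinations of
    their values at the e_j with nonnegative coefficients. *)
Lemma dual_leP (f g : dual E) :
  dual_le (coordinate_le es) f g <-> forall j, (f (e j) : R) <= g (e j).
Proof.
split=> [fg j|fg x x0].
  by apply: fg => i; rewrite linear0 es_biorth ler0n.
apply: ler_cvg_to (@dual_cvg f x) (@dual_cvg g x) _.
exists 0 => // n _; apply: ler_sum => j _; apply: ler_wpM2l => //.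
by have := x0 j; rewrite linear0.
Qed.

End unconditional_basis.

(** * Lattice p-sums computed coordinate by coordinate *)

Section concavity_duality.
Context {R : realType} {E : completeNormedModType R}.
Variables (e : normalized_1unconditional_basis E) (es : nat -> dual E).
Hypothesis es_biorth : biorthogonal e es.
Variable p : \bar R.
Hypothesis p_ge1 : (1 <= p)%E.

Lemma lp_norm_pairing_le n (a b : 'I_n -> R) :
  lp_norm (hoelder_conjugate p) a <= 1 ->
  \sum_(i < n) a i * b i <= lp_norm p b.
Proof.
move=> a1; apply: le_trans (ler_norm _) _; apply: le_trans (ler_norm_sum _ _ _) _.
under eq_bigr do rewrite normrM.
apply: le_trans (lp_hoelder _ _ p_ge1) _.
by rewrite ler_piMl// lp_norm_ge0.
Qed.

(** By [dual_leP] the supremum can be checked at each e_j, where it is the duality of [l_p] and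
    [l_p']. *)
Lemma dual_lattice_lp n (x : 'I_n -> dual E) (y : dual E) :
  (forall j, y (e j) = lp_norm p (fun i => x i (e j))) ->
  is_lattice_lp (dual_le (coordinate_le es)) p x y.
Proof.
have sumE (a : 'I_n -> R) j :
    (\sum_(i < n) a i *: x i) (e j) = \sum_(i < n) a i * x i (e j) :> R.
  by rewrite dual_sumE.
move=> yE; split=> [_ [a /= a1 <-]|z zub].
  apply/(dual_leP es_biorth) => j; rewrite yE sumE.
  exact: lp_norm_pairing_le.
apply/(dual_leP es_biorth) => j; rewrite yE.
have [a a1 <-] := lp_norm_attained (fun i => x i (e j) : R) p_ge1.
rewrite -sumE; suff /(dual_leP es_biorth) : dual_le (coordinate_le es)
  (\sum_(i < n) a i *: x i) z by exact.
by apply: zub; exists a.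
Qed.

Lemma coord_linear_sum n (a : 'I_n -> R) (x : 'I_n -> E) j :
  es j (\sum_(i < n) a i *: x i) = \sum_(i < n) a i * es j (x i) :> R.
Proof. by rewrite linear_sum; apply: eq_bigr => i _; rewrite linearZ. Qed.

(** A least upper bound is minimal in each coordinate separately, since a change by a multiple of
    e_j stays in E; the minimal value is given by [l_p] duality. *)
Lemma lattice_lp_coord n (x : 'I_n -> E) (y : E) :
  is_lattice_lp (coordinate_le es) p x y <->
  (forall j, es j y = lp_norm p (fun i => es j (x i))).
Proof.
split=> [[yub ylub] j|yE]; last first.
  split=> [_ [a /= a1 <-] j|z zub j].
    by rewrite yE coord_linear_sum; exact: lp_norm_pairing_le.
  rewrite yE.
  have [a a1 <-] := lp_norm_attained (fun i => es j (x i) : R) p_ge1.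
  by rewrite -coord_linear_sum; apply: zub; exists a.
pose v : R := lp_norm p (fun i => es j (x i)).
apply/le_anti/andP; split; last first.
  have [a a1 <-] := lp_norm_attained (fun i => es j (x i) : R) p_ge1.
  by rewrite -coord_linear_sum; apply: yub; exists a.
have coordD k (c : R) z : es k (y + c *: z) = es k y + c * es k z :> R.
  by rewrite linearD linearZ.
(* Lowering the [j]-th coordinate of [y] to [v] leaves an upper bound. *)
suff /(ylub _)/(_ j) : forall w, [set \sum_(i < n) a i *: x i | a in
    [set a : 'I_n -> R | lp_norm (hoelder_conjugate p) a <= 1]] w ->
    coordinate_le es w (y + (v - es j y) *: e j).
  by rewrite coordD es_biorth eqxx mulr1 addrC subrK.
move=> _ [a /= a1 <-] k; rewrite coordD es_biorth.
have [->|kj] := eqVneq k j.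
  by rewrite mulr1 addrC subrK coord_linear_sum lp_norm_pairing_le.
by rewrite mulr0 addr0; apply: yub; exists a.
Qed.

End concavity_duality.

(** * Exchange of p-convexity of the dual and p'-concavity of E *)

Section duality.
Context {R : realType} {E : completeNormedModType R}.
Variables (e : normalized_1unconditional_basis E) (es : nat -> dual E).
Hypothesis es_biorth : biorthogonal e es.
Variable p : \bar R.
Hypothesis p_ge1 : (1 <= p)%E.

(* p-convexity of the dual, restricted to truncations to the first [m]
   coordinates; it follows both from a convexity bound for the dual and from a
   concavity bound for [E]. *)
Definition finite_dual_convexity (K : R) :=
  forall m n (g : 'I_n -> dual E),
    `|\sum_(j < m) (lp_norm p (fun i => g i (e j)) : R) *: es j| <=
    K * lp_norm p (fun i => `|g i|).

Let p_gt0 : (0 < p)%E. Proof. exact: lt_le_trans p_ge1. Qed.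

Let q_ge1 : (1 <= hoelder_conjugate p)%E.
Proof. exact: hoelder_conj_ge1. Qed.

Let q_gt0 : (0 < hoelder_conjugate p)%E. Proof. exact: lt_le_trans q_ge1. Qed.

(** The g_i are truncated to m coordinates; this does not increase their norms, and makes their
    lattice p-sum a finite combination of the [es j]. *)
Lemma convexity_bound_finite K :
  convexity_bound (dual_le (coordinate_le es)) p K -> finite_dual_convexity K.
Proof.
move=> [K0 KP] m n g.
pose x i : dual E := \sum_(j < m) (g i (e j) : R) *: es j.
apply: le_trans (KP n x _ _) _.
  apply: dual_lattice_lp => // j.
  have xE i : x i (e j) = (if (j < m)%N then g i (e j) else 0) :> R.
    exact: (dual_sum_basis es_biorth j m (fun j => g i (e j))).
  rewrite (eq_lp_norm p xE).
  rewrite (dual_sum_basis es_biorth j m (fun j => lp_norm p (fun i => g i (e j)))).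
  by case: ifP => // _; rewrite lp_norm0.
rewrite ler_wpM2l// lp_norm_le// => i; rewrite !normr_id.
by apply: (dual_dominated es_biorth (b := fun j => g i (e j))) => j.
Qed.

(** At a vector x, the left-hand functional is bounded by a sum of pairings g_i(u_i) with suitable
    u_i in E; Hölder's inequality over i and concavity for the u_i bound this sum. *)
Lemma concavity_bound_finite K :
  concavity_bound (coordinate_le es) (hoelder_conjugate p) K ->
  finite_dual_convexity K.
Proof.
move=> [K0 KP] m n g.
have [t tP] : exists t : nat -> 'I_n -> R, forall j,
    lp_norm (hoelder_conjugate p) (t j) <= 1 /\
    \sum_(i < n) t j i * g i (e j) = lp_norm p (fun i => g i (e j)).
  have /choice [t tP] : forall j, exists a : 'I_n -> R,
      lp_norm (hoelder_conjugate p) a <= 1 /\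
      \sum_(i < n) a i * g i (e j) = lp_norm p (fun i => g i (e j)).
    move=> j; have [a a1 aE] := lp_norm_attained (fun i => g i (e j) : R) p_ge1.
    by exists a.
  by exists t.
apply: dual_norm_leP => [|x]; first by rewrite mulr_ge0// lp_norm_ge0.
(* t_j norms the family (g_i(e_j))_i. The coordinates of y are the [l_p'] norms of those of the u_i,
   at most |es_j x| because [l j] <= 1. *)
pose u i : E := \sum_(j < m) (t j i * `|es j x|) *: e j.
pose l j := lp_norm (hoelder_conjugate p) (t j).
pose y : E := \sum_(j < m) (l j * `|es j x|) *: e j.
have yx : `|y| <= `|x|.
  apply: (coord_dominated es_biorth (a := fun j => l j * `|es j x|)) => j _.
  rewrite normrM normr_id ger0_norm ?lp_norm_ge0//.
  by rewrite ler_piMl//; case: (tP j).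
have uy : is_lattice_lp (coordinate_le es) (hoelder_conjugate p) u y.
  apply/(lattice_lp_coord es_biorth q_ge1) => j.
  have uE i : es j (u i) = (if (j < m)%N then t j i * `|es j x| else 0) :> R.
    exact: (sum_coord es_biorth j m (fun j => t j i * `|es j x|)).
  rewrite (eq_lp_norm _ uE).
  rewrite (sum_coord es_biorth j m (fun j => l j * `|es j x|)).
  by case: ifP => _; [rewrite lp_normZ|rewrite lp_norm0].
apply: (@le_trans _ _ (\sum_(i < n) `|g i| * `|u i|)); last first.
  have := lp_hoelder (fun i => `|u i|) (fun i => `|g i|) p_ge1.
  under eq_bigr do rewrite !normr_id mulrC.
  move=> /le_trans; apply; rewrite mulrC [K * _]mulrC -mulrA.
  rewrite ler_wpM2l ?lp_norm_ge0//; apply: le_trans (KP n u y uy) _.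
  by rewrite ler_wpM2l.
rewrite dual_sumE; apply: le_trans (ler_norm_sum _ _ _) _.
apply: (@le_trans _ _ (\sum_(i < n) (g i (u i) : R))); last first.
  by apply: ler_sum => i _; apply: le_trans (ler_norm _) (ler_dual _ _).
rewrite [leRHS](eq_bigr (fun i =>
  \sum_(j < m) t j i * `|es j x| * g i (e j))); last first.
  by move=> i _; exact: (dual_coord_sum e (g i) m (fun j => t j i * `|es j x|)).
rewrite exchange_big; apply: ler_sum => j _.
rewrite dual_scale_mul normrM ger0_norm ?lp_norm_ge0//.
have [_ <-] := tP j; rewrite mulr_suml le_eqVlt; apply/orP; left; apply/eqP.
by apply: eq_bigr => i _; rewrite mulrAC.
Qed.

(** Hahn-Banach on the coefficients gives c below the norm; c defines a combination of the [es j],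
    of norm at most 1 because truncation does not increase norms. *)
Lemma norming_functional m x : exists f : dual E,
  `|f| <= 1 /\ \sum_(j < m) es j x * f (e j) = `|\sum_(j < m) es j x *: e j|.
Proof.
have [c [cle cE]] := @sublinear_minorant R E (fun x => `|x|) (@ler_normD _ _)
  (fun t x t0 => etrans (normrZ t x) (congr1 ( *%R^~ `|x|) (ger0_norm t0)))
  m e (fun j => es j x).
exists (\sum_(j < m) c j *: es j); split.
  apply: dual_norm_leP => // z; rewrite mul1r dual_sumE.
  under eq_bigr do rewrite dual_scale_mul mulrC.
  have zE (b : nat -> R) : (forall j, `|b j| = `|es j z|) ->
      \sum_(j < m) b j * c j <= `|z|.
    move=> bz; apply: le_trans (cle b) _.
    by apply: coord_dominated => // j _; rewrite bz.
  rewrite ler_norml (zE (fun j => es j z))// andbT lerNl -sumrN.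
  under eq_bigr do rewrite -mulNr.
  by apply: (zE (fun j => - es j z)) => j; rewrite normrN.
rewrite -cE; apply: eq_bigr => j _.
by rewrite (dual_sum_basis es_biorth j m c) ltn_ord.
Qed.

(** The numbers |x_i| are normed by weights a in the unit ball of [l_p], and truncations of the x_i
    by functionals f_i. The lattice p-sum h of the |a_i| f_i has norm at most K, and Hölder's
    inequality in each coordinate bounds the sum by h(y). *)
Lemma finite_concavity_bound K : 0 <= K ->
  finite_dual_convexity K ->
  concavity_bound (coordinate_le es) (hoelder_conjugate p) K.
Proof.
move=> K0 KP; split=> // n x y /(lattice_lp_coord es_biorth q_ge1) yE.
have [a] := lp_norm_attained (fun i => `|x i|) q_ge1.
rewrite hoelder_conjugateK => a1 <-.
apply: (@le_trans _ _ (\sum_(i < n) `|a i| * `|x i|)).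
  by apply: ler_sum => i _; rewrite ler_wpM2r// ler_norm.
have xcvg : \sum_(i < n) `|a i| * `|\sum_(j < m) es j (x i) *: e j|
    @[m --> \oo] --> \sum_(i < n) `|a i| * `|x i|.
  apply: cvg_big => [|i _]; first exact: add_continuous.
  by apply: cvgMl_tmp; apply: cvg_norm; exact: coord_cvg.
rewrite -(cvg_lim (@Rhausdorff R) xcvg); apply: limr_le.
  by apply/cvg_ex; exists (\sum_(i < n) `|a i| * `|x i|).
exists 0 => // m _ /=.
have /choice [f fP] := fun i => norming_functional m (x i).
pose g i := `|a i| *: f i.
pose h : dual E := \sum_(j < m) (lp_norm p (fun i => g i (e j)) : R) *: es j.
apply: (@le_trans _ _ (h y)); last first.
  apply: le_trans (ler_norm _) _; apply: le_trans (ler_dual _ _) _.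
  rewrite ler_wpM2r//; apply: le_trans (KP m n g) _.
  rewrite ler_piMr//; apply: le_trans _ a1; apply: lp_norm_le => // i.
  rewrite normr_id normrZ normr_id ler_piMr//; by case: (fP i).
rewrite dual_sumE; under eq_bigr => i _.
  rewrite -(proj2 (fP i)) mulr_sumr; over.
rewrite exchange_big; apply: ler_sum => j _.
rewrite dual_scale_mul yE mulrC.
have := lp_hoelder (fun i => es j (x i) : R) (fun i => g i (e j) : R) p_ge1.
apply: le_trans; apply: ler_sum => i _.
rewrite mulrCA; apply: le_trans (ler_norm _) _.
by rewrite normrM.
Qed.

End duality.

(** * Finite families testing the p-summing norm *)

Section summing_families.
Context {R : realType} {V W : normedModType R}.
Variable r : R.
Hypothesis r_gt0 : 0 < r.

Lemma powR_homog (c x : R) : `|c * x| `^ r = `|c| `^ r * `|x| `^ r.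
Proof. by rewrite normrM powRM. Qed.

Lemma powR_invK (x : R) : 0 <= x -> (x `^ r^-1) `^ r = x.
Proof. by move=> x0; rewrite -powRrM mulVf ?gt_eqF// powRr1. Qed.

Lemma powR_Kinv (x : R) : 0 <= x -> (x `^ r) `^ r^-1 = x.
Proof. by move=> x0; rewrite -powRrM divff ?gt_eqF// powRr1. Qed.

Lemma ler_powR_cancel (x y : R) : 0 <= x -> 0 <= y -> x `^ r <= y `^ r -> x <= y.
Proof.
move=> x0 y0 xy; rewrite -(powR_Kinv x0) -(powR_Kinv y0).
by rewrite ge0_ler_powR ?invr_ge0 ?nnegrE ?powR_ge0// ltW.
Qed.

Lemma sum_powR_ge0 (I : Type) (s : seq I) (F : I -> R) :
  0 <= \sum_(i <- s) F i `^ r.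
Proof. by apply: sumr_ge0 => i _; exact: powR_ge0. Qed.

(** A bound on the r-th power of the weak [l_r] norm. Lists are used because families from different
    summands get concatenated. *)
Definition weakly_bounded (s : seq V) (w : R) :=
  forall f : dual V, `|f| <= 1 -> \sum_(x <- s) `|f x| `^ r <= w.

Lemma weakly_boundedZ s w (f : dual V) : weakly_bounded s w -> 0 <= w ->
  \sum_(x <- s) `|f x| `^ r <= `|f| `^ r * w.
Proof.
move=> sw w0; have [f0|f0] := eqVneq f 0.
  rewrite big1 ?mulr_ge0 ?powR_ge0// => x _.
  by rewrite f0 normr0 powR0// gt_eqF.
have nf : 0 < `|f| by rewrite normr_gt0.
have := sw (`|f|^-1 *: f); rewrite normrZ normfV normr_id mulVf ?gt_eqF//.
move=> /(_ (lexx 1)); under eq_bigr do rewrite dual_scale_mul powR_homog.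
rewrite -mulr_sumr normfV normr_id -ler_pdivlMl; last first.
  by rewrite powR_gt0// invr_gt0.
by rewrite -(powR_inv1 (normr_ge0 f)) -powRrM mulN1r powRN invrK.
Qed.

Lemma summing_bound_seq (T : V -> W) C s w : summing_bound r%:E T C ->
  0 <= w -> weakly_bounded s w ->
  \sum_(x <- s) `|T x| `^ r <= C `^ r * w.
Proof.
move=> [C0 TC] w0 sw.
pose x (i : 'I_(size s)) := nth 0 s i.
have sE (F : V -> R) : \sum_(x <- s) F x = \sum_i F (x i).
  by rewrite (big_nth 0) big_mkord.
have := TC _ x; rewrite sE => Tx.
have wx : weak_lp_norm r%:E x <= w `^ r^-1.
  apply: ge_sup.
    exists (lp_norm r%:E (fun i => (0 : dual V) (x i))), 0 => //=.
    by rewrite normr0.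
  move=> _ [f /= f1 <-].
  rewrite ge0_ler_powR ?invr_ge0 ?(ltW r_gt0)// ?nnegrE ?sum_powR_ge0//.
  by have := sw f f1; rewrite sE.
have : lp_norm r%:E (fun i => `|T (x i)|) <= C * w `^ r^-1.
  by apply: le_trans Tx _; rewrite ler_wpM2l.
move=> /(ge0_ler_powR (ltW r_gt0)); rewrite !nnegrE lp_norm_ge0.
rewrite mulr_ge0 ?powR_ge0// lp_norm_powR// powRM ?powR_ge0// powR_invK//.
by under eq_bigr do rewrite normr_id; apply.
Qed.

Lemma not_summing_bound_seq (T : V -> W) b : 0 <= b ->
  ~ summing_bound r%:E T b -> exists s w, [/\ 0 <= w, weakly_bounded s w &
    b `^ r * w < \sum_(x <- s) `|T x| `^ r].
Proof.
move=> b0 /not_andP[//|/existsNP[n /existsNP[x /negP]]]; rewrite -ltNge => bx.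
pose s := [seq x i | i <- enum 'I_n].
have sE (F : V -> R) : \sum_(x <- s) F x = \sum_i F (x i).
  by rewrite big_map big_enum.
have w0 : 0 <= weak_lp_norm r%:E x.
  have [_ ub] : True /\ has_ubound
      [set lp_norm r%:E (fun i => f (x i)) | f in [set f : dual V | `|f| <= 1]].
    by split=> //; apply: weak_lp_norm_has_ub; rewrite lte_fin.
  apply: le_trans (ub_le_sup ub (ex_intro2 _ _ 0 _ erefl)).
    exact: lp_norm_ge0.
  by rewrite /= normr0.
exists s, (weak_lp_norm r%:E x `^ r); split.
- exact: powR_ge0.
- move=> f f1; rewrite sE -lp_norm_powR//.
  apply: (ge0_ler_powR (ltW r_gt0)); [exact: lp_norm_ge0|exact: w0|].
  apply: ub_le_sup; last by exists f.
  by apply: weak_lp_norm_has_ub; rewrite lte_fin.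
- rewrite sE -powRM//; under eq_bigr do rewrite -[`|T _|]normr_id.
  rewrite -(lp_norm_powR (fun i => `|T (x i)|))//.
  by rewrite gt0_ltr_powR// ?nnegrE ?mulr_ge0// ?lp_norm_ge0.
Qed.

(** One real bound makes the infimum of all bounds a real number, so [fine] loses nothing. *)
Lemma summing_normP p (T : V -> W) C : summing_bound p T C ->
  [/\ summing_norm p T \is a fin_num, 0 <= fine (summing_norm p T),
      fine (summing_norm p T) <= C &
      forall b, b < fine (summing_norm p T) -> ~ summing_bound p T b].
Proof.
move=> TC; pose A := [set c | summing_bound p T c].
have lbA : has_lbound A by exists 0 => c [].
have nE : summing_norm p T = (inf A)%:E.
  by rewrite -ereal_inf_EFin//; exists C.
rewrite nE; split => //=.
- by apply: lb_le_inf => [|c []//]; exists C.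
- exact: ge_inf.
- by move=> b bA Tb; have := ge_inf lbA Tb; rewrite leNgt bA.
Qed.

(** A constant slightly below the norm fails on some family, which is then rescaled to weak bound
    1. *)
Lemma summing_norm_approx (T : V -> W) C u :
  (forall c x, T (c *: x) = c *: T x) -> summing_bound r%:E T C ->
  0 <= u < 1 ->
  exists s, weakly_bounded s 1 /\
    u * fine (summing_norm r%:E T) `^ r <= \sum_(x <- s) `|T x| `^ r.
Proof.
move=> TZ TC /andP[u0 u1]; have [_ a0 aC aP] := summing_normP TC.
set a := fine _ in a0 aC aP *.
have [->|an0] := eqVneq a 0.
  exists [::]; split; first by move=> f _; rewrite big_nil.
  by rewrite big_nil powR0 ?gt_eqF// mulr0.
have {an0}a_gt0 : 0 < a by rewrite lt0r an0.
(* Chosen so that b^r = u a^r. *)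
pose b := u `^ r^-1 * a.
have b0 : 0 <= b by rewrite mulr_ge0 ?powR_ge0.
have ba : b < a.
  rewrite -[ltRHS]mul1r ltr_pM2r// -[ltRHS](congr1 (@^~ r^-1) (powR1 R)).
  by rewrite gt0_ltr_powR ?invr_gt0 ?nnegrE.
have [s [w [w0 sw bs]]] := not_summing_bound_seq b0 (aP _ ba).
(* For w = 0 the bound C would force the sum to vanish, against the strict inequality [bs]. *)
have {w0}w_gt0 : 0 < w.
  rewrite lt0r w0 andbT; apply: contraTneq bs => wE.
  have := summing_bound_seq TC w0 sw; rewrite wE !mulr0.
  by rewrite -leNgt.
pose k := (w^-1) `^ r^-1.
have kr : `|k| `^ r = w^-1.
  by rewrite ger0_norm ?powR_ge0// powR_invK// invr_ge0 ltW.
exists [seq k *: x | x <- s]; split=> [f f1|].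
  rewrite big_map; under eq_bigr do rewrite dualZ powR_homog.
  by rewrite -mulr_sumr kr mulrC ler_pdivrMr// mul1r sw.
rewrite big_map; under eq_bigr do rewrite TZ normrZ powRM//.
rewrite -mulr_sumr kr ler_pdivlMl// mulrC.
by apply: le_trans (ltW bs); rewrite /b powRM ?powR_ge0// powR_invK.
Qed.

End summing_families.

(** * Functionals and summing operators on the direct sum *)

Section direct_sum_dual.
Context {R : realType} {E : completeNormedModType R}.
Variables (e : normalized_1unconditional_basis E) (es : nat -> dual E).
Hypothesis es_biorth : biorthogonal e es.
Variable X : nat -> completeNormedModType R.

Lemma sum_inj_coord m (w : forall n, X n) n :
  (\sum_(j < m) dsum_inj e (w j)) n = if (n < m)%N then w n else 0.
Proof.
have -> : (\sum_(j < m) dsum_inj e (w j)) n = \sum_(j < m) (dsum_inj e (w j) n).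
  by apply: (big_morph (fun z : direct_sum e X => z n)).
have injE j : dsum_inj e (w j) n = if j == n then w n else 0.
  rewrite -[LHS]/(eqtype.dfwith _ _ _); have [->|jn] := eqVneq j n.
    by rewrite eqtype.dfwith_in.
  by rewrite eqtype.dfwith_out.
under eq_bigr do rewrite injE.
case: ltnP => nm; last first.
  by rewrite big1// => j _; rewrite ltn_eqF// (leq_trans (ltn_ord j)).
rewrite (bigD1 (Ordinal nm))//= eqxx big1 ?addr0// => j jn.
by rewrite -val_eqE in jn; rewrite (negbTE jn).
Qed.

Lemma sum_inj_norm m (w : forall n, X n) :
  `|\sum_(j < m) dsum_inj e (w j)| = `|\sum_(j < m) `|w j| *: e j|.
Proof.
rewrite [LHS]/(dsum_norm _) /dsum_norm; congr `|_|.
apply/cvg_lim => //; apply: cvg_near_cst; exists m => //= n /= mn.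
rewrite /series/= big_mkord (big_ord_widen n (fun j => `|w j| *: e j))//.
rewrite [RHS]big_mkcond/=; apply: eq_bigr => j _.
by rewrite sum_inj_coord; case: ifP; rewrite ?normr0 ?scale0r.
Qed.

Lemma dual_restr (f : dual (direct_sum e X)) n :
  exists g : dual (X n), forall x, g x = f (dsum_inj e x).
Proof.
apply: (@bounded_linear_dual _ _ _ `|f|) => [a x y|x].
  by rewrite dsum_inj_linear linearP.
by apply: le_trans (ler_dual _ _) _; rewrite dsum_norm_inj.
Qed.

Lemma dual_norm_near (V : normedModType R) (f : dual V) u : 0 <= u < 1 ->
  exists x, `|x| <= 1 /\ u * `|f| <= f x.
Proof.
move=> /andP[u0 u1]; have [f0|f0] := eqVneq f 0.
  by exists 0; split; rewrite ?normr0 ?ler01// f0 normr0 mulr0.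
have nf : 0 < `|f| by rewrite normr_gt0.
have uf : 0 < (1 - u) * `|f| by rewrite mulr_gt0 ?subr_gt0.
have [_ [x /= x1 <-]] := sup_adherent uf (dual_norm_has_sup f).
rewrite -[X in X - _]/(`|f|) mulrBl mul1r opprB addrC subrK => ufx.
exists (Num.sg (f x) *: x); split.
  by rewrite normrZ normr_sg; case: (_ != _); rewrite ?mul1r ?mul0r.
by rewrite dualZ -normrEsg ltW.
Qed.

(** Allows choices that are optimal only up to a factor u < 1. If B < A, the factor (A + B) / (2A)
    takes A to the midpoint, which exceeds B. *)
Lemma le_of_scaled (A B : R) : 0 <= B -> (forall u, 0 <= u < 1 -> u * A <= B) ->
  A <= B.
Proof.
move=> B0 AB; rewrite leNgt; apply/negP => BA.
have A0 : 0 < A by exact: le_lt_trans BA.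
have := AB ((A + B) / (2 * A)); have -> : (A + B) / (2 * A) * A = (A + B) / 2.
  by field; rewrite gt_eqF.
rewrite divr_ge0 ?addr_ge0 ?mulr_ge0 ?(ltW A0)//=.
rewrite ltr_pdivrMr ?mulr_gt0//; lra.
Qed.

(** Vectors of the unit balls of the X_j that almost norm the g_j, multiplied by |es_j x|, add up to
    an element of norm at most |x| on which f almost attains sum_j |g_j| |es_j x|. *)
Lemma dual_restr_norm (f : dual (direct_sum e X)) (g : forall n, dual (X n)) m :
  (forall n x, g n x = f (dsum_inj e x)) ->
  `|\sum_(j < m) (`|g j| : R) *: es j| <= `|f|.
Proof.
move=> gf; apply: dual_norm_leP => // x; rewrite dual_sumE.
apply: le_trans (ler_norm_sum _ _ _) _.
apply: le_of_scaled => [|u u01]; first exact: mulr_ge0.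
have yP j := cid (dual_norm_near (g j) u01).
pose w j := `|es j x| *: sval (yP j).
apply: (@le_trans _ _ (f (\sum_(j < m) dsum_inj e (w j)))).
  have -> : f (\sum_(j < m) dsum_inj e (w j)) = \sum_(j < m) g j (w j) :> R.
    by rewrite linear_sum; apply: eq_bigr => j _; rewrite gf.
  rewrite mulr_sumr; apply: ler_sum => j _; rewrite dual_scale_mul dualZ.
  rewrite normrM normr_id mulrA [leRHS]mulrC ler_wpM2r//.
  by case: (svalP (yP j)).
apply: le_trans (ler_norm _) _; apply: le_trans (ler_dual _ _) _.
rewrite ler_wpM2l// sum_inj_norm.
apply: (coord_dominated es_biorth (a := fun j => `|w j|)) => j _.
rewrite normr_id normrZ normr_id ler_piMr//.
by case: (svalP (yP j)).
Qed.

Variables (Z : normedModType R) (r : R).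
Hypothesis r_gt0 : 0 < r.

Lemma summing_norm_weights (S : direct_sum e X -> Z) C m (l : nat -> R) :
  (forall c x, S (c *: x) = c *: S x) -> summing_bound r%:E S C ->
  (forall j, 0 <= l j) ->
  (forall g : dual E, `|g| <= 1 ->
     \sum_(j < m) l j * `|g (e j)| `^ r <= 1) ->
  \sum_(j < m) l j * fine (summing_norm r%:E (dsum_restr S j)) `^ r <= C `^ r.
Proof.
move=> SZ SC l0 lP; apply: le_of_scaled => [|u u01]; first exact: powR_ge0.
have SjZ j c x : dsum_restr S j (c *: x) = c *: dsum_restr S j x.
  by rewrite /dsum_restr -SZ linearZ.
have SjC j : summing_bound r%:E (dsum_restr S j) C.
  have [C0 SC'] := SC; split=> // n x.
  apply: le_trans (SC' n (fun i => dsum_inj e (x i))) _.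
  by rewrite ler_wpM2l// weak_lp_norm_inj// lte_fin.
have sP j := cid (summing_norm_approx r_gt0 (SjZ j) (SjC j) u01).
pose s j := sval (sP j).
pose k j := l j `^ r^-1.
have kr j : `|k j| `^ r = l j by rewrite ger0_norm ?powR_ge0// powR_invK.
(* Near-optimal families of the summands, the j-th one scaled by l_j^(1/r), form one test family for
   S. *)
pose F :=
  flatten [seq [seq k j *: dsum_inj e x | x <- s j] | j <- index_iota 0 m].
have FE (G : direct_sum e X -> R) : \sum_(y <- F) G y =
    \sum_(j < m) \sum_(x <- s j) G (k j *: dsum_inj e x).
  rewrite big_flatten/= big_map big_mkord.
  by apply: eq_bigr => j _; rewrite big_map.
have Fw : weakly_bounded r F 1.
  move=> f f1; have gP j := cid (dual_restr f j).
  pose g j := sval (gP j).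
  have gf j x : g j x = f (dsum_inj e x) by exact: (svalP (gP j)).
  rewrite FE; set h := \sum_(j < m) (`|g j| : R) *: es j.
  (* The hypothesis on the weights is applied to h, whose value at e_j is the norm of f restricted
     to X_j. *)
  have h1 : `|h| <= 1 by exact: le_trans (dual_restr_norm m gf) f1.
  apply: le_trans _ (lP h h1); apply: ler_sum => j _.
  under eq_bigr do rewrite dualZ powR_homog kr -gf.
  rewrite -mulr_sumr ler_wpM2l//.
  rewrite (dual_sum_basis es_biorth j m (fun j => `|g j|)) ltn_ord normr_id.
  have [sw _] := svalP (sP j).
  by have := weakly_boundedZ r_gt0 (g j) sw ler01; rewrite mulr1.
have := summing_bound_seq r_gt0 SC ler01 Fw; rewrite mulr1; apply: le_trans.
rewrite FE mulr_sumr; apply: ler_sum => j _.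
under eq_bigr do rewrite SZ normrZ powRM// kr.
rewrite -mulr_sumr mulrCA ler_wpM2l//.
by case: (svalP (sP j)).
Qed.

End direct_sum_dual.

(** * The convexification and its linear minorants *)

Section convex_hull.
Context {R : realType} {E : completeNormedModType R}.
Variables (e : normalized_1unconditional_basis E) (es : nat -> dual E).
Hypothesis es_biorth : biorthogonal e es.
Variable r : R.
Hypothesis r_gt0 : 0 < r.
Variable m : nat.

Definition hull_sums (b : nat -> R) : set R :=
  [set \sum_(g <- G) `|g| `^ r | G in [set G : seq (dual E) |
     forall j, (j < m)%N -> b j <= \sum_(g <- G) `|g (e j)| `^ r]].

(* The convexification of [b |-> |sum_j b_j^(1/r) es_j|^r], a function on the
   positive cone, extended to all [b] by monotonicity. *)
Definition hull (b : nat -> R) : R := inf (hull_sums b).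

Lemma hull_sums_lb b : has_lbound (hull_sums b).
Proof. by exists 0 => _ [G _ <-]; exact: sum_powR_ge0. Qed.

Lemma hull_sums_nonempty b : hull_sums b !=set0.
Proof.
pose g := \sum_(j < m) (`|b j| `^ r^-1) *: es j.
exists (\sum_(h <- [:: g]) `|h| `^ r), [:: g] => //= j jm.
rewrite big_seq1 (dual_sum_basis es_biorth j m (fun j => `|b j| `^ r^-1)) jm.
by rewrite ger0_norm ?powR_ge0// powR_invK// ler_norm.
Qed.

Lemma hull_le b (G : seq (dual E)) :
  (forall j, (j < m)%N -> b j <= \sum_(g <- G) `|g (e j)| `^ r) ->
  hull b <= \sum_(g <- G) `|g| `^ r.
Proof. by move=> bG; apply: ge_inf; [exact: hull_sums_lb|exists G]. Qed.

Lemma le_hull b x :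
  (forall G : seq (dual E),
    (forall j, (j < m)%N -> b j <= \sum_(g <- G) `|g (e j)| `^ r) ->
    x <= \sum_(g <- G) `|g| `^ r) -> x <= hull b.
Proof.
move=> xG; apply: lb_le_inf; first exact: hull_sums_nonempty.
by move=> _ [G GP <-]; exact: xG.
Qed.

(** Concatenating lists admissible for a and b gives one admissible for a + b. *)
Lemma hullD a b : hull (a + b) <= hull a + hull b.
Proof.
rewrite -lerBlDr; apply: le_hull => G aG; rewrite lerBlDr [leRHS]addrC -lerBlDr.
apply: le_hull => H bH; rewrite lerBlDr [leRHS]addrC -big_cat/=.
apply: hull_le => j jm.
by rewrite big_cat/= lerD ?aG ?bH.
Qed.

Lemma hull_nil b : (forall j, (j < m)%N -> b j <= 0) -> hull b <= 0.
Proof.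
move=> b0; have := @hull_le b [::]; rewrite big_nil; apply => j jm.
by rewrite big_nil b0.
Qed.

Lemma hull_ge0 b : 0 <= hull b.
Proof. by apply: le_hull => G _; exact: sum_powR_ge0. Qed.

(** Scaling a list by s^(1/r) gives one inequality for s > 0; the other follows from 1/s. *)
Lemma hullZ t b : 0 <= t -> hull (t *: b) = t * hull b.
Proof.
have le_hullZ s c : 0 < s -> hull (s *: c) <= s * hull c.
  move=> s0; rewrite -ler_pdivrMl//; apply: le_hull => G cG.
  have kr : `|s `^ r^-1| `^ r = s by rewrite ger0_norm ?powR_ge0// powR_invK// ltW.
  rewrite ler_pdivrMl//.
  have -> : s * \sum_(g <- G) `|g| `^ r =
      \sum_(h <- [seq s `^ r^-1 *: g | g <- G]) `|h| `^ r.
    rewrite big_map mulr_sumr; apply: eq_bigr => g _.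
    by rewrite normrZ powRM// kr.
  apply: hull_le => j jm; rewrite big_map.
  under eq_bigr do rewrite dual_scale_mul powR_homog kr.
  by rewrite -mulr_sumr ler_pM2l// cG.
rewrite le_eqVlt => /predU1P[<-|t0].
  rewrite mul0r; apply/le_anti; rewrite hull_ge0 andbT; apply: hull_nil => j _.
  by rewrite scale0r.
apply/le_anti; rewrite le_hullZ//=.
have := @le_hullZ t^-1 (t *: b); rewrite invr_gt0 scalerA mulVf ?gt_eqF// scale1r.
by move=> /(_ t0); rewrite ler_pdivlMl.
Qed.

(* The weights [l] used in the proof are a linear minorant of [hull] which is
   exact at [(a_j^r)_j]. *)
Lemma convexity_weights (a : nat -> R) C K : (forall j, 0 <= a j) ->
  0 <= C -> 0 <= K -> finite_dual_convexity e es r%:E K ->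
  (forall l : nat -> R, (forall j, 0 <= l j) ->
    (forall g : dual E, `|g| <= 1 ->
       \sum_(j < m) l j * `|g (e j)| `^ r <= 1) ->
    \sum_(j < m) l j * a j `^ r <= C `^ r) ->
  `|\sum_(j < m) a j *: es j| <= K * C.
Proof.
move=> a0 C0 K0 KP aC.
pose v (j : nat) : nat -> R := fun k => (j == k)%:R.
have vE (b : nat -> R) k : (k < m)%N -> (\sum_(j < m) b j *: v j) k = b k.
  move=> km; have -> : (\sum_(j < m) b j *: v j) k = \sum_(j < m) b j * v j k.
    by rewrite fct_sumE.
  rewrite (bigD1 (Ordinal km))//= /v eqxx mulr1 big1 ?addr0// => j jk.
  by rewrite -val_eqE in jk; rewrite (negbTE jk) mulr0.
have [c [cle cE]] :=
  @sublinear_minorant R (nat -> R) hull hullD hullZ m v (fun j => a j `^ r).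
(* The empty list is admissible for -v_k, so the minorant is at most 0 there. *)
have c0 k : (k < m)%N -> 0 <= c k.
  move=> km; have := cle (fun j => - v k j).
  rewrite (bigD1 (Ordinal km))//= /v eqxx mulN1r big1 ?addr0 => [|j jk].
    move=> ck; rewrite -oppr_le0; apply: le_trans ck _; apply: hull_nil => j jm.
    by rewrite (vE (fun j => - (k == j)%:R))// oppr_le0 ler0n.
  by rewrite -val_eqE eq_sym in jk; rewrite (negbTE jk) oppr0 mul0r.
(* The weights must be nonnegative at every index, while c is controlled only below m; hence
   |c_j|. *)
have cN (b : nat -> R) :
    \sum_(j < m) `|c j| * b j = \sum_(j < m) b j * c j.
  by apply: eq_bigr => j _; rewrite ger0_norm ?c0// mulrC.
(* The weights are admissible because the list [g] bounds the hull of (|g(e_j)|^r)_j by |g|^r;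
   exactness at (a_j^r)_j then bounds the hull there. *)
have hC : hull (\sum_(j < m) (a j `^ r) *: v j) <= C `^ r.
  rewrite -cE -(cN (fun j => a j `^ r)); apply: (aC (fun j => `|c j|)) => // g g1.
  rewrite (cN (fun j => `|g (e j)| `^ r)).
  apply: le_trans (cle (fun j => `|g (e j)| `^ r)) _.
  apply: (@le_trans _ _ (`|g| `^ r)).
    have := @hull_le (\sum_(j < m) (`|g (e j)| `^ r) *: v j) [:: g].
    rewrite big_seq1; apply => j jm.
    by rewrite (vE (fun j => `|g (e j)| `^ r))// big_seq1.
  rewrite -[leRHS](congr1 (@^~ r) (powR1 R)).
  by rewrite ge0_ler_powR ?nnegrE// ltW.
(* For any admissible list, a_j is at most the j-th coefficient of its lattice sum, to which
   p-convexity applies. *)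
have aK (G : seq (dual E)) : (forall j, (j < m)%N ->
    (\sum_(j < m) (a j `^ r) *: v j) j <= \sum_(g <- G) `|g (e j)| `^ r) ->
    `|\sum_(j < m) a j *: es j| `^ r <= K `^ r * \sum_(g <- G) `|g| `^ r.
  move=> aG; pose g (i : 'I_(size G)) := nth 0 G i.
  have gE (F : dual E -> R) : \sum_(h <- G) F h = \sum_i F (g i).
    by rewrite (big_nth 0) big_mkord.
  pose d j := lp_norm r%:E (fun i => g i (e j)).
  have ad : `|\sum_(j < m) a j *: es j| <= K * lp_norm r%:E (fun i => `|g i|).
    apply: le_trans (KP m _ g); apply: (dual_dominated es_biorth) => j jm.
    rewrite (dual_sum_basis es_biorth j m d) jm (ger0_norm (a0 j)).
    rewrite (ger0_norm (lp_norm_ge0 _ _)) le_powR_inv ?sum_powR_ge0//.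
    by have := aG j jm; rewrite (vE (fun j => a j `^ r))// gE.
  apply: le_trans (ge0_ler_powR (ltW r_gt0) _ _ ad) _.
  - exact: normr_ge0.
  - by rewrite nnegrE mulr_ge0// lp_norm_ge0.
  rewrite powRM ?lp_norm_ge0// lp_norm_powR// gE.
  by under eq_bigr do rewrite normr_id.
have {}aK : `|\sum_(j < m) a j *: es j| `^ r <= (K * C) `^ r.
  (* Division by K^r is impossible if it vanishes; any one admissible list then gives the claim. *)
  rewrite powRM//; have [Kr0|Kr0] := eqVneq (K `^ r) 0.
    have [_ [G GP _]] := hull_sums_nonempty (\sum_(j < m) (a j `^ r) *: v j).
    by have := aK G GP; rewrite Kr0 !mul0r.
  have Krp : 0 < K `^ r by rewrite lt0r Kr0 powR_ge0.
  rewrite mulrC -ler_pdivrMr//; apply: le_trans _ hC.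
  by apply: le_hull => G GP; rewrite ler_pdivrMr// mulrC aK.
exact: (ler_powR_cancel r_gt0 (normr_ge0 _) (mulr_ge0 K0 C0)).
Qed.

End convex_hull.

(** * The estimate for finite sums *)

Section multiplier_bound.
Context {R : realType} {E : completeNormedModType R}.
Variables (e : normalized_1unconditional_basis E) (es : nat -> dual E).
Hypothesis es_biorth : biorthogonal e es.
Variable X : nat -> completeNormedModType R.
Variables (Z : normedModType R) (p : \bar R).
Hypothesis p_ge1 : (1 <= p)%E.

Lemma summing_bound_restr (S : direct_sum e X -> Z) C j :
  summing_bound p S C -> summing_bound p (dsum_restr S j) C.
Proof.
have p_gt0 : (0 < p)%E by exact: lt_le_trans p_ge1.
case: p p_gt0 => [r| |]// p_gt0 [C0 SC]; split=> //.
- move=> n x; apply: le_trans (SC n (fun i => dsum_inj e (x i))) _.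
  by rewrite ler_wpM2l// weak_lp_norm_inj.
- by move=> x; apply: le_trans (SC _) _; rewrite dsum_norm_inj.
Qed.

(** Combines the weights with the convexification for finite p. Homogeneity is a plain hypothesis so
    that the tails of T, given as bare functions, qualify. *)
Lemma summing_norm_sum_le (S : direct_sum e X -> Z) C K m :
  (forall c x, S (c *: x) = c *: S x) -> summing_bound p S C ->
  0 <= K -> finite_dual_convexity e es p K ->
  `|\sum_(j < m) (fine (summing_norm p (dsum_restr S j)) : R) *: es j| <= K * C.
Proof.
move=> SZ SC K0 KP; have [C0 _] := SC.
pose a j := fine (summing_norm p (dsum_restr S j)).
have aP j := summing_normP (summing_bound_restr j SC).
have a0 j : 0 <= a j by case: (aP j).
have aC j : a j <= C by case: (aP j).
move: (p_ge1) SC KP @a aP a0 aC; case: p => [r||//] r1 SC KP a _ a0 aC.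
  have r0 : 0 < r by rewrite lee_fin in r1; exact: lt_le_trans ltr01 r1.
  apply: (convexity_weights es_biorth r0 a0 C0 K0 KP) => l l0 lP.
  exact: (summing_norm_weights es_biorth r0).
(* For p = +oo these functionals have norm at most C, and their maximum at e_j is at least a_j. *)
pose g (i : 'I_m) := a i *: es i.
apply: (@le_trans _ _ (K * lp_norm +oo%E (fun i => `|g i|))).
  apply: le_trans (KP m m g).
  apply: (dual_dominated es_biorth (b := a)) => j jm.
  rewrite (dual_sum_basis es_biorth j m
    (fun j => lp_norm +oo%E (fun i => g i (e j)))) jm (ger0_norm (a0 j)).
  rewrite (ger0_norm (lp_norm_ge0 _ _)).
  have := @lp_norm_coord R +oo%E m (fun i => g i (e j)) (Ordinal jm) (ltry 0).
  by rewrite dual_scale_mul es_biorth eqxx mulr1 ger0_norm.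
rewrite ler_wpM2l//; apply/bigmax_leP; split=> // i _.
rewrite normr_id normrZ (ger0_norm (a0 i)).
by apply: le_trans (aC i); rewrite ler_piMr// (dual_coord_norm_le es_biorth).
Qed.

End multiplier_bound.

(** * Completeness of the dual *)

Section dual_completeness.
Context {R : realType} {V : normedModType R}.

(** The Cauchy estimate, relative to |x|, passes to the pointwise limit; this gives both its
    boundedness and convergence in norm. *)
Lemma dual_cvg_of_cauchy (u : nat -> dual V) :
  (forall eps, 0 < eps ->
     exists N, forall n, (N <= n)%N -> `|u n - u N| <= eps) ->
  cvgn u.
Proof.
move=> uc.
have uc2 eps : 0 < eps -> exists N, forall n k, (N <= n)%N -> (N <= k)%N ->
    forall x, `|u n x - u k x| <= eps * `|x|.
  move=> eps0; have [|N NP] := uc (eps / 2); first by rewrite divr_gt0.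
  exists N => n k Nn Nk x; rewrite -[X in `|X|]/((u n - u k) x).
  apply: le_trans (ler_dual _ _) _; rewrite ler_wpM2r//.
  rewrite -(subrKA (u N)); apply: le_trans (ler_normD _ _) _.
  by rewrite [leRHS]splitr lerD ?NP// distrC NP.
have ux x : cvgn (fun n => u n x : R).
  apply/cauchy_cvgP/cauchy_exP => eps eps0.
  have [|N NP] := uc2 (eps / (`|x| + 1)).
    by rewrite divr_gt0// ltr_wpDl.
  exists (u N x); exists N => // n /= Nn; rewrite -ball_normE/=.
  apply: le_lt_trans (NP N n (leqnn N) Nn x) _.
  by rewrite mulrAC ltr_pdivrMr ?ltr_wpDl// ltr_pM2l// ltrDl.
pose f x : R := limn (fun n => u n x : R).
have uf eps : 0 < eps -> exists N, forall n, (N <= n)%N ->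
    forall x, `|u n x - f x| <= eps * `|x|.
  move=> eps0; have [N NP] := uc2 _ eps0; exists N => n Nn x.
  have : `|u n x - u k x| @[k --> \oo] --> `|u n x - f x|.
    by apply: cvg_norm; apply: cvgB; [exact: cvg_cst|exact: ux].
  move=> ucvg; rewrite -(cvg_lim (@Rhausdorff R) ucvg).
  apply: limr_le; first by apply/cvg_ex; exists `|u n x - f x|.
  by exists N => // k /= Nk; exact: NP.
have [N0 N0P] := uf 1 ltr01.
have [g gf] : exists g : dual V, forall x, g x = f x.
  apply: (@bounded_linear_dual _ _ f (`|u N0| + 1)) => [a x y|x].
    rewrite /f; apply/cvg_lim => //.
    under eq_fun do rewrite linearP.
    by apply: cvgD; [apply: cvgZl_tmp; exact: ux|exact: ux].
  have -> : f x = u N0 x - (u N0 x - f x) by rewrite opprB addrC subrK.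
  apply: le_trans (ler_normB _ _) _; rewrite mulrDl lerD// ?ler_dual//.
  exact: N0P.
apply/cvg_ex; exists g; apply/cvgrPdist_le => eps eps0.
have [N NP] := uf _ eps0; exists N => // n /= Nn.
rewrite distrC; apply: dual_norm_leP; first exact: ltW.
by move=> x; rewrite -[X in `|X|]/(u n x - g x : R) gf NP.
Qed.

End dual_completeness.

(** * Passage to the optimal constants and the theorem *)

(** The infima are taken one after the other. If x > 0, all factors are positive, which permits the
    divisions. *)
Lemma le_mule_ereal_inf (R : realType) (A B : set R) (x : R) :
  A !=set0 -> B !=set0 -> (forall a, A a -> 0 <= a) -> (forall b, B b -> 0 <= b) ->
  (forall a b, A a -> B b -> x <= a * b) ->
  (x%:E <= ereal_inf [set a%:E | a in A] * ereal_inf [set b%:E | b in B])%E.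
Proof.
move=> A0 B0 Age Bge xAB.
rewrite !ereal_inf_EFin//; [|by exists 0 => b /Bge..|by exists 0 => a /Age].
rewrite -EFinM lee_fin.
have iA : 0 <= inf A by apply: lb_le_inf => // a /Age.
have iB : 0 <= inf B by apply: lb_le_inf => // b /Bge.
have [x0|x0] := leP x 0; first by rewrite (le_trans x0)// mulr_ge0.
have Ap a : A a -> 0 < a.
  move=> Aa; have [b Bb] := B0; have ab0 := lt_le_trans x0 (xAB a b Aa Bb).
  rewrite lt0r Age// andbT; apply: contraTneq ab0 => ->.
  by rewrite mul0r ltxx.
have xa a : A a -> x <= a * inf B.
  move=> Aa; rewrite mulrC -ler_pdivrMr ?Ap//; apply: lb_le_inf => // b Bb.
  by rewrite ler_pdivrMr ?Ap// mulrC xAB.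
have {}iB : 0 < inf B.
  have [a Aa] := A0; have aB0 := lt_le_trans x0 (xa a Aa).
  by rewrite lt0r iB andbT; apply: contraTneq aB0 => ->; rewrite mulr0 ltxx.
by rewrite -ler_pdivrMr//; apply: lb_le_inf => // a Aa; rewrite ler_pdivrMr// xa.
Qed.

Theorem theorem1p4 (R : realType) (E : completeNormedModType R)
    (e : normalized_1unconditional_basis E)
    (es : nat -> dual E) (es_biorth : biorthogonal e es)
    (X : nat -> completeNormedModType R) (Z : completeNormedModType R)
    (p : \bar R) (p_ge1 : (1 <= p)%E)
    (T : {linear direct_sum e X -> Z}) (T_summing : summing p T)
    (Estar_convex : convex_lattice (dual_le (coordinate_le es)) p) :
  (forall m : nat,
     (`|\sum_(j < m) fine (summing_norm p (dsum_restr T j)) *: es j|%:E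
      <= convexity_constant (dual_le (coordinate_le es)) p * summing_norm p T)%E)
  /\
  ((boundedly_complete es \/
    (summing_norm p (fun x : direct_sum e X =>
       T x - \sum_(j < N) dsum_restr T j (x j)) @[N --> \oo] --> 0%E)) ->
   [/\ concave_lattice (coordinate_le es) (hoelder_conjugate p),
       cvgn (series (fun j => fine (summing_norm p (dsum_restr T j)) *: es j)) &
       (`|limn (series (fun j =>
            fine (summing_norm p (dsum_restr T j)) *: es j))|%:E
        <= concavity_constant (coordinate_le es) (hoelder_conjugate p)
           * summing_norm p T)%E]).

Proof.
pose a j := fine (summing_norm p (dsum_restr T j)).
have [C0 TC0] := T_summing.
have aP j := summing_normP (summing_bound_restr p_ge1 j TC0).
have a0 j : 0 <= a j by case: (aP j).
have TZ c x : T (c *: x) = c *: T x by rewrite linearZ.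
have partial K C m : 0 <= K -> finite_dual_convexity e es p K ->
    summing_bound p T C -> `|\sum_(j < m) a j *: es j| <= K * C.
  by move=> K0 KP TC; exact: (summing_norm_sum_le es_biorth p_ge1 m TZ TC K0 KP).
have [K0 K0P] := Estar_convex; have [K0_ge0 _] := K0P.
have FK0 := convexity_bound_finite es_biorth p_ge1 K0P.
split=> [m|hcvg].
  apply: le_mule_ereal_inf; [by exists K0|by exists C0|by move=> K []|
    by move=> C []|].
  move=> K C KP TC; apply: partial => //; first by case: KP.
  exact: (convexity_bound_finite es_biorth p_ge1 KP).
have seriesE n : series (fun j => a j *: es j) n = \sum_(j < n) a j *: es j.
  by rewrite /series/= big_mkord.
have KE : concavity_bound (coordinate_le es) (hoelder_conjugate p) K0.
  exact: (finite_concavity_bound es_biorth p_ge1 K0_ge0 FK0).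
have acvg : cvgn (series (fun j => a j *: es j)).
  (* Under bounded completeness, the uniform bound on partial sums suffices; otherwise they are
     shown to be Cauchy. *)
  case: hcvg => [bc|tail].
    apply: bc; exists (K0 * C0); split=> [|M MK n _]; first exact: num_real.
    have := partial K0 C0 n K0_ge0 FK0 TC0.
    by rewrite -seriesE => /le_trans; apply; exact: ltW.
  apply: dual_cvg_of_cauchy => eps eps0.
  (* K0 may be 0, hence the denominator K0 + 1. *)
  have epsK : 0 < eps / (K0 + 1) by rewrite divr_gt0// ltr_wpDl.
  pose tailT N (x : direct_sum e X) := T x - \sum_(j < N) dsum_restr T j (x j).
  have [N _ NP] : \forall N \near \oo,
      (summing_norm p (tailT N) < (eps / (K0 + 1))%:E)%E.
    apply: (tail [set y | (y < (eps / (K0 + 1))%:E)%E]).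
    apply: open_nbhs_nbhs; split; first exact: open_ereal_lt_ereal.
    by rewrite /= lte_fin.
  exists N => n Nn; pose S := tailT N.
  have [_ [C SC <-]] := ereal_inf_lt (NP N (leqnn N)).
  rewrite lte_fin => Ceps.
  have SZ c x : S (c *: x) = c *: S x.
    rewrite /S /tailT TZ scalerBr scaler_sumr; congr (_ - _); apply: eq_bigr => j _.
    by rewrite /dsum_restr -TZ -linearZ.
  (* The tail S agrees with T on X_k for k >= N, so the a_k beyond N are summing norms of
     restrictions of S. *)
  have ST k : (N <= k)%N -> dsum_restr S k = dsum_restr T k.
    move=> Nk; apply/funext => y; rewrite /dsum_restr /S /tailT big1 ?subr0// => j _.
    rewrite /dsum_restr -[dsum_val _ _]/(eqtype.dfwith _ _ _).
    rewrite eqtype.dfwith_out; first by rewrite !linear0.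
    by rewrite gtn_eqF// (leq_trans (ltn_ord j)).
  rewrite !seriesE.
  have -> : \sum_(j < n) a j *: es j - \sum_(j < N) a j *: es j =
      \sum_(j < n) (if (N <= j)%N then a j else 0) *: es j.
    apply/eqP; rewrite subr_eq; apply/eqP.
    rewrite (big_ord_widen n (fun j => a j *: es j) Nn) [X in _ + X]big_mkcond/=.
    rewrite -big_split/=; apply: eq_bigr => j _.
    by case: ltnP => _; rewrite ?scale0r ?add0r ?addr0.
  have SP j := summing_normP (summing_bound_restr p_ge1 j SC).
  apply: (@le_trans _ _ (K0 * C)).
    apply: le_trans (summing_norm_sum_le es_biorth p_ge1 n SZ SC K0_ge0 FK0).
    (* The coefficients below N are 0 in the difference, so the full sum for S dominates it. *)
    apply: (dual_dominated es_biorth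
      (b := fun j => if (N <= j)%N then a j else 0)) => j jn.
    rewrite (dual_sum_basis es_biorth j n
      (fun j => fine (summing_norm p (dsum_restr S j)))) jn.
    by case: ifP => [Nj|_]; rewrite ?normr0// ST.
  have CN : 0 <= C by case: SC.
  apply: (@le_trans _ _ ((K0 + 1) * (eps / (K0 + 1)))).
    by apply: ler_pM => //; [rewrite lerDl|exact: ltW].
  by rewrite mulrC divfK// gt_eqF// ltr_wpDl.
split=> //; first by exists K0.
apply: le_mule_ereal_inf; [by exists K0|by exists C0|by move=> K []|
  by move=> C []|].
(* The bound holds for all partial sums with any concavity constant K, and the norm passes to the
   limit. *)
move=> K C KP TC; rewrite -lim_norm//; apply: limr_le.
  exact: is_cvg_norm.
apply: nearW => n; rewrite [X in `|X|]seriesE; apply: partial => //.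
  by case: KP.
exact: (concavity_bound_finite es_biorth p_ge1 KP).
Qed.
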